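(* Let $X$ and $Y$ be Banach spaces, and let $a\in\mathrm{SCD}(B_X)$ and $b\in\mathrm{SCD}(B_Y)$. Assume that (1) every bounded linear operator $T:X\to Y^*$ is compact; (2) $b$ is a preserved extreme point of $B_Y$. Then $a\otimes b\in\mathrm{SCD}\bigl(B_{X\widehat{\otimes}_\pi Y}\bigr)$.
   Context: Banach spaces are over $\mathbb{K}=\mathbb{R}$ or $\mathbb{C}$; $B_X$ and $X^*$ denote the closed unit ball and the topological dual of $X$. A slice of a bounded set $A\subseteq X$ is a non-empty intersection of $A$ with an open half-space; it can be written as $S(A,x^*,\alpha)=\{x\in A:\operatorname{Re}x^*(x)>\sup_{b\in A}\operatorname{Re}x^*(b)-\alpha\}$ with $x^*\in X^*$, $\alpha>0$. Let $A\subseteq X$ be bounded and convex and $a\in A$. A countable collection $\{V_n:n\in\mathbb{N}\}$ of non-empty subsets of $A$ is determining for $a$ if $a\in\overline{\mathrm{conv}}(B)$ whenever $B\subseteq A$ intersects all the sets $V_n$. The point $a$ is an SCD point (slicely countably determined point) of $A$ if there is a sequence of slices of $A$ that is determining for $a$; $\mathrm{SCD}(A)$ is the set of all SCD points of $A$. An extreme point of $A\subseteq X$ is a preserved extreme point of $A$ if it is an extreme point of the weak* closure of $A$ in $X^{**}$. The projective tensor product $X\widehat{\otimes}_\pi Y$ is the completion of the algebraic tensor product $X\otimes Y$ under the norm $\|u\|=\inf\{\sum_{i=1}^n\|x_i\|\|y_i\|:u=\sum_{i=1}^n x_i\otimes y_i\}$. *)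

(* Defs.v *)
From HB Require Import structures.
From mathcomp Require Import all_boot all_order all_algebra generic_quotient.
From mathcomp Require Import all_classical all_reals all_analysis.
From mathcomp Require Import complex ring lra.

Set Implicit Arguments.
Unset Strict Implicit.
Unset Printing Implicit Defensive.

Import Order.TTheory GRing.Theory Num.Theory.
Import numFieldNormedType.Exports.

Local Open Scope classical_set_scope.
Local Open Scope ring_scope.

Variant scalar_kind := real_scalars | complex_scalars.

(* The scalar field is R or C: results quantified over [k] cover both cases. *)
Definition scalars (R : realType) (k : scalar_kind) : numFieldType :=
  match k with
  | real_scalars => R
  | complex_scalars => R[i]
  end.

Section Scalars.
Context {R : realType} {k : scalar_kind}.
Implicit Types (a : scalars R k) (r s : R).

Definition re : scalars R k -> R :=
  match k with
  | real_scalars => id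
  | complex_scalars => @complex.Re R
  end.

Definition of_real : R -> scalars R k :=
  match k with
  | real_scalars => id
  | complex_scalars => fun r => (r +i* 0)%C
  end.

Lemma of_realK : cancel of_real re. Proof. by rewrite /of_real /re; case: k. Qed.

Lemma reK a : 0 <= a -> of_real (re a) = a.
Proof.
rewrite /of_real /re; case: k a => //= a a0.
by move: (a0); rewrite lecE => /andP[/eqP /=]; case: a {a0} => x y /= ->.
Qed.

Lemma reD : {morph re : a b / a + b}.
Proof. by rewrite /re; case: k => //= -[a b] [c d]. Qed.

Lemma reN : {morph re : a / - a}.
Proof. by rewrite /re; case: k => //= -[a b]. Qed.

Lemma of_realD : {morph of_real : r s / r + s}.
Proof. by rewrite /of_real; case: k => //= r s; rewrite -[RHS]/(Complex (r + s) (0 + 0)) addr0. Qed.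

Lemma of_realM : {morph of_real : r s / r * s}.
Proof.
rewrite /of_real; case: k => //= r s.
by rewrite -[RHS]/(Complex (r * s - 0 * 0) (r * 0 + 0 * s)) !(mulr0, mul0r) addr0 subr0.
Qed.

Lemma of_real0 : of_real 0 = 0.
Proof. by rewrite /of_real; case: k. Qed.

Lemma of_real1 : of_real 1 = 1.
Proof. by rewrite /of_real; case: k. Qed.

Lemma le_of_real : {mono of_real : r s / r <= s}.
Proof. by rewrite /of_real; case: k => //= r s; rewrite lecR. Qed.

Lemma lt_of_real : {mono of_real : r s / r < s}.
Proof. by rewrite /of_real; case: k => //= r s; rewrite ltcR. Qed.

Lemma le_re a b : a <= b -> re a <= re b.
Proof. by rewrite /re; case: k a b => //= a b; rewrite lecE => /andP[]. Qed.

Lemma re_norm_le a : `|re a| <= re `|a|.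
Proof.
rewrite /re; case: k a => //= a.
by have := normc_ge_Re a; rewrite lecE => /andP[_]; apply: le_trans.
Qed.

Lemma reM_real r a : re (of_real r * a) = r * re a.
Proof.
rewrite /re /of_real; case: k a => //= -[x y].
by rewrite -[LHS]/(r * x - 0 * y) mul0r subr0.
Qed.

End Scalars.

Section RealNorm.
Context {R : realType} {k : scalar_kind} {V : normedModType (scalars R k)}.
Implicit Types (x y : V).

(* The norm of a [normedModType K] takes its values in K, even for K = R[i];
   [rnorm] is the same norm with values in R (see [rnormK]). *)
Definition rnorm (x : V) : R := re `|x|.

Lemma rnormK x : of_real (rnorm x) = `|x|.
Proof. exact: reK. Qed.

Lemma rnorm_ge0 x : 0 <= rnorm x.
Proof. by rewrite -(@le_of_real R k) rnormK of_real0. Qed.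

Lemma rnormD x y : rnorm (x + y) <= rnorm x + rnorm y.
Proof. by rewrite -(@le_of_real R k) of_realD !rnormK ler_normD. Qed.

Lemma rnorm0 : rnorm 0 = 0.
Proof. by rewrite /rnorm normr0 -(@of_real0 R k) of_realK. Qed.

Lemma rnorm0_eq0 x : rnorm x = 0 -> x = 0.
Proof. by move=> x0; apply/normr0_eq0; rewrite -rnormK x0 of_real0. Qed.

Lemma rnormZ (a : scalars R k) x : rnorm (a *: x) = re `|a| * rnorm x.
Proof. by rewrite /rnorm normrZ -{1}(reK (normr_ge0 a)) reM_real. Qed.

Definition unit_ball : set V := [set x | `|x| <= 1].

Lemma unit_ballE x : unit_ball x <-> rnorm x <= 1.
Proof. by rewrite /unit_ball /= -rnormK -(@of_real1 R k) le_of_real. Qed.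

End RealNorm.

Section Dual.
Context {R : realType} {k : scalar_kind}.
Notation K := (scalars R k).
Variable X : normedModType K.

Definition dual_pred : {pred X -> K^o} :=
  fun f => `[< linear f /\ continuous f >].

(* The topological dual X^*, normed below by the operator norm [dual_norm]. *)
Record dual := Dual { dual_fun :> X -> K^o; dual_funP : dual_fun \in dual_pred }.

HB.instance Definition _ := [isSub for dual_fun].
HB.instance Definition _ := [Choice of dual by <:].

Lemma dual_submod_closed : submod_closed dual_pred.
Proof.
split.
  apply/asboolP; split; last exact: cst_continuous.
  by move=> a x y /=; rewrite scaler0 addr0.
move=> a f g /asboolP[fl fc] /asboolP[gl gc]; apply/asboolP; split.
  move=> b x y.
  rewrite -[LHS]/(a *: f (b *: x + y) + g (b *: x + y)) fl gl.
  by rewrite !scalerDr addrACA !scalerA (mulrC a b).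
move=> x; apply: (@continuousD _ _ _ (a \*: f) g x); last exact: gc.
by apply: continuousZr; exact: fc.
Qed.

HB.instance Definition _ :=
  GRing.isSubmodClosed.Build K (X -> K^o) dual_pred dual_submod_closed.
HB.instance Definition _ := [SubChoice_isSubLmodule of dual by <:].

Lemma dual_linear (f : dual) : linear f.
Proof. by have /asboolP[] := dual_funP f. Qed.

HB.instance Definition _ (f : dual) :=
  GRing.isLinear.Build K X K^o _ (dual_fun f) (@dual_linear f).

Lemma dual_continuous (f : dual) : continuous f.
Proof. by have /asboolP[] := dual_funP f. Qed.

Definition dual_norm (f : dual) : R := sup [set rnorm (f x) | x in unit_ball].

Lemma dual_norm_has_sup (f : dual) :
  has_sup [set rnorm (f x) | x in unit_ball].
Proof.
split; first by exists (rnorm (f 0)), 0; rewrite // /unit_ball /= normr0.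
have /linear_bounded_continuous/bounded_funP/(_ 1)[M fM] := @dual_continuous f.
by exists (re M) => _ [x /fM fxM <-]; exact: le_re.
Qed.

Lemma dual_norm_ge (f : dual) x : unit_ball x -> rnorm (f x) <= dual_norm f.
Proof. by move=> x1; apply: sup_ubound; [case: (dual_norm_has_sup f)|exists x]. Qed.

Lemma dual_norm_le (f : dual) (r : R) :
  (forall x, unit_ball x -> rnorm (f x) <= r) -> dual_norm f <= r.
Proof.
move=> fr; apply: ge_sup; first by case: (dual_norm_has_sup f).
by move=> _ [x x1 <-]; exact: fr.
Qed.

Lemma dual_norm_triangle (f g : dual) :
  dual_norm (f + g) <= dual_norm f + dual_norm g.
Proof.
apply: dual_norm_le => x x1; apply: le_trans (rnormD _ _) _.
by apply: lerD; exact: dual_norm_ge.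
Qed.

Lemma dual_norm_ge0 (f : dual) : 0 <= dual_norm f.
Proof.
apply: le_trans (rnorm_ge0 (f 0)) (dual_norm_ge _ _).
by rewrite /unit_ball /= normr0.
Qed.

Lemma dual_norm_scale (a : K) (f : dual) :
  dual_norm (a *: f) = re `|a| * dual_norm f.
Proof.
have le b g : dual_norm (b *: g) <= re `|b| * dual_norm g.
  apply: dual_norm_le => x x1; rewrite [X in X <= _]rnormZ.
  by apply: ler_wpM2l; [exact: (@rnorm_ge0 _ _ K^o)|exact: dual_norm_ge].
have [->|a0] := eqVneq a 0.
  apply/eqP; rewrite eq_le le /= normr0 -(@of_real0 R k) of_realK mul0r.
  exact: dual_norm_ge0.
apply/eqP; rewrite eq_le le /=.
have := le a^-1 (a *: f); rewrite scalerA mulVf // scale1r => /(ler_wpM2l (@rnorm_ge0 _ _ K^o a)).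
rewrite mulrA => /le_trans; apply.
by rewrite -(@reM_real R k) rnormK -normrM mulfV// normr1 -(@of_real1 R k) of_realK mul1r.
Qed.

Lemma dual_norm_eq0 (f : dual) : dual_norm f = 0 -> f = 0.
Proof.
move=> f0; apply/val_inj/funext => x /=; have [->|x0] := eqVneq x 0; first exact: linear0.
have nx0 : `|x| != 0 by rewrite normr_eq0.
have : rnorm (f (`|x|^-1 *: x)) <= 0.
  by rewrite -f0; apply: dual_norm_ge; rewrite /unit_ball /= normrZ normfV normr_id mulVf.
rewrite le_eqVlt ltNge rnorm_ge0 orbF => /eqP/rnorm0_eq0.
by rewrite linearZ /= => /eqP; rewrite scaler_eq0 invr_eq0 (negPf nx0) => /eqP.
Qed.

Let dnorm f : K := of_real (dual_norm f).
Let dnormD f g : dnorm (f + g) <= dnorm f + dnorm g.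
Proof. by rewrite -of_realD le_of_real dual_norm_triangle. Qed.
Let dnormZ a f : dnorm (a *: f) = `|a| * dnorm f.
Proof. by rewrite /dnorm dual_norm_scale of_realM reK. Qed.
Let dnorm0 f : dnorm f = 0 -> f = 0.
Proof. by move=> /(congr1 re); rewrite /dnorm of_realK -(@of_real0 R k) of_realK; exact: dual_norm_eq0. Qed.

HB.instance Definition _ := Lmodule_isNormed.Build K dual dnormD dnormZ dnorm0.

Lemma dual_rnormE (f : dual) : rnorm f = dual_norm f.
Proof. exact: of_realK. Qed.

End Dual.

Section Bidual.
Context {R : realType} {k : scalar_kind}.
Notation K := (scalars R k).
Variable X : normedModType K.

Lemma dual_bound (f : dual X) x : rnorm (f x) <= dual_norm f * rnorm x.
Proof.
have [->|x0] := eqVneq x 0; first by rewrite linear0 !rnorm0 mulr0.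
have nx0 : `|x| != 0 by rewrite normr_eq0.
rewrite -(@le_of_real R k) of_realM !rnormK.
have : rnorm (f (`|x|^-1 *: x)) <= dual_norm f.
  by apply: dual_norm_ge; rewrite /unit_ball /= normrZ normfV normr_id mulVf.
rewrite -(@le_of_real R k) rnormK linearZ /= normrZ normfV normr_id.
by rewrite mulrC ler_pdivrMr // normr_gt0.
Qed.

Definition eval_at (x : X) : dual X -> K^o := fun f => f x.

Lemma eval_at_dual x : eval_at x \in @dual_pred R k (dual X).
Proof.
have evl : linear (eval_at x) by [].
apply/asboolP; split => //.
pose ev : {linear dual X -> K^o} := HB.pack (eval_at x)
  (GRing.isLinear.Build K (dual X) K^o _ (eval_at x) evl).
apply: (@bounded_linear_continuous _ _ _ ev).
apply/bounded_funP => r; exists (r * `|x|) => f fr.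
rewrite -[leLHS]rnormK; apply: le_trans (_ : of_real (rnorm f * rnorm x) <= _).
  by rewrite le_of_real dual_rnormE dual_bound.
by rewrite of_realM !rnormK ler_wpM2r.
Qed.

Definition to_bidual (x : X) : dual (dual X) := Dual (eval_at_dual x).

End Bidual.

Section WeakStar.
Context {R : realType} {k : scalar_kind}.
Notation K := (scalars R k).

(* X^* with the topology of pointwise convergence on X. *)
Definition weak_star (X : normedModType K) :=
  initial_topology (fun f : dual X => (f : X -> K^o) : {ptws X -> K^o}).

Definition weak_star_closure (X : normedModType K) (A : set (dual X)) :
  set (dual X) := closure (A : set (weak_star X)).

End WeakStar.

Section Geometry.
Context {R : realType} {k : scalar_kind}.
Notation K := (scalars R k).

(* The order of R[i] only compares numbers with equal imaginary parts, so
   [0 < t < 1] forces t to be real. *)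
Definition extreme_point (V : lmodType K) (A : set V) (a : V) : Prop :=
  A a /\ forall (x y : V) (t : K), A x -> A y -> 0 < t < 1 ->
    a = t *: x + (1 - t) *: y -> x = a /\ y = a.

Definition preserved_extreme_point (X : normedModType K) (A : set X) (a : X) :
    Prop :=
  extreme_point A a /\
  extreme_point (weak_star_closure (@to_bidual R k X @` A)) (to_bidual a).

Definition compact_operator (X Y : normedModType K) (T : X -> Y) : Prop :=
  compact (closure (T @` unit_ball)).

Variable X : normedModType K.
Implicit Types (A B V : set X) (a : X).

(* Slices, determining sequences and SCD points are only meant for a bounded set
   A, on which the supremum below is the genuine one. *)
Definition slice A (f : dual X) (alpha : R) : set X :=
  [set x | A x /\ re (f x) > sup [set re (f b) | b in A] - alpha].

Definition is_slice A V : Prop :=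
  V !=set0 /\ exists (f : dual X) (alpha : R), 0 < alpha /\ V = slice A f alpha.

Definition conv_hull B : set X := smallest (@convex_set K X) B.

Definition determining A a (V : nat -> set X) : Prop :=
  (forall n, V n !=set0 /\ V n `<=` A) /\
  forall B, B `<=` A -> (forall n, B `&` V n !=set0) -> closure (conv_hull B) a.

Definition SCD A : set X :=
  [set a | A a /\
    exists V : nat -> set X, (forall n, is_slice A (V n)) /\ determining A a V].

End Geometry.

Section AlgebraicTensor.
Variables (K : fieldType) (X Y : lmodType K).
Implicit Types (s t : seq (X * Y)).

(* A list [:: (x_1, y_1); ...; (x_n, y_n)] stands for the formal sum of the
   x_i (x) y_i; [tensor_rel] is the congruence making (x) bilinear.  Scaling a
   formal sum scales the left factors. *)
Inductive tensor_rel : seq (X * Y) -> seq (X * Y) -> Prop :=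
| tensor_refl s : tensor_rel s s
| tensor_sym s t : tensor_rel s t -> tensor_rel t s
| tensor_trans t s u : tensor_rel s t -> tensor_rel t u -> tensor_rel s u
| tensor_cat s s' t t' :
    tensor_rel s s' -> tensor_rel t t' -> tensor_rel (s ++ t) (s' ++ t')
| tensor_catC s t : tensor_rel (s ++ t) (t ++ s)
| tensor_0l y : tensor_rel [:: (0, y)] [::]
| tensor_Dl x x' y : tensor_rel [:: (x + x', y)] [:: (x, y); (x', y)]
| tensor_Dr x y y' : tensor_rel [:: (x, y + y')] [:: (x, y); (x, y')]
| tensor_Z (c : K) x y : tensor_rel [:: (c *: x, y)] [:: (x, c *: y)].

Definition tensor_relb s t := `[< tensor_rel s t >].

Lemma tensor_relb_refl : reflexive tensor_relb.
Proof. by move=> s; apply/asboolP/tensor_refl. Qed.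

Lemma tensor_relb_sym : symmetric tensor_relb.
Proof. by move=> s t; apply/asboolP/asboolP => /tensor_sym. Qed.

Lemma tensor_relb_trans : transitive tensor_relb.
Proof.
by move=> t s u /asboolP st /asboolP tu; apply/asboolP/(tensor_trans st).
Qed.

Canonical tensor_equiv :=
  EquivRel tensor_relb tensor_relb_refl tensor_relb_sym tensor_relb_trans.

Definition tensor := {eq_quot tensor_equiv}%qT.
HB.instance Definition _ := Choice.on tensor.
HB.instance Definition _ := EqQuotient.on tensor.

Definition tensor_of s : tensor := (\pi_tensor s)%qT.

Lemma tensor_ofP s t : tensor_of s = tensor_of t <-> tensor_rel s t.
Proof.
split=> [/eqquotP/asboolP //|st].
by apply/eqquotP/asboolP.
Qed.

Lemma tensor_ind (P : tensor -> Prop) : (forall s, P (tensor_of s)) -> forall u, P u.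
Proof. by move=> Ps u; rewrite -[u]reprK; apply: Ps. Qed.

Definition scale_seq (c : K) s := [seq (c *: p.1, p.2) | p <- s].

Lemma scale_seq_rel c s t :
  tensor_rel s t -> tensor_rel (scale_seq c s) (scale_seq c t).
Proof.
elim=> /= {s t}; rewrite /scale_seq /=.
- by move=> s; apply: tensor_refl.
- by move=> s t _; apply: tensor_sym.
- by move=> t s u _ + _; apply: tensor_trans.
- by move=> s s' t t' _ ss' _ tt'; rewrite !map_cat; apply: tensor_cat.
- by move=> s t; rewrite !map_cat; apply: tensor_catC.
- by move=> y; rewrite scaler0; apply: tensor_0l.
- by move=> x x' y; rewrite scalerDr; apply: tensor_Dl.
- by move=> x y y'; apply: tensor_Dr.
- move=> d x y; rewrite scalerA mulrC -scalerA; exact: tensor_Z.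
Qed.

Definition tensor_add (u v : tensor) := tensor_of (repr u ++ repr v).
Definition tensor_scale c (u : tensor) := tensor_of (scale_seq c (repr u)).

Lemma tensor_repr s : tensor_rel (repr (tensor_of s)) s.
Proof. by apply/tensor_ofP; rewrite /tensor_of reprK. Qed.

Lemma tensor_addE s t : tensor_add (tensor_of s) (tensor_of t) = tensor_of (s ++ t).
Proof. by apply/tensor_ofP/tensor_cat; exact: tensor_repr. Qed.

Lemma tensor_scaleE c s : tensor_scale c (tensor_of s) = tensor_of (scale_seq c s).
Proof. by apply/tensor_ofP/scale_seq_rel/tensor_repr. Qed.

Lemma tensor_consE p s :
  tensor_of (p :: s) = tensor_add (tensor_of [:: p]) (tensor_of s).
Proof. by rewrite tensor_addE. Qed.

Fact tensor_addA : associative tensor_add.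
Proof.
elim/tensor_ind => s; elim/tensor_ind => t; elim/tensor_ind => u.
by rewrite !tensor_addE catA.
Qed.

Fact tensor_addC : commutative tensor_add.
Proof.
elim/tensor_ind => s; elim/tensor_ind => t.
by rewrite !tensor_addE; apply/tensor_ofP/tensor_catC.
Qed.

Fact tensor_add0 : left_id (tensor_of [::]) tensor_add.
Proof. by elim/tensor_ind => s; rewrite tensor_addE. Qed.

Fact tensor_scaleDl u c d :
  tensor_scale (c + d) u = tensor_add (tensor_scale c u) (tensor_scale d u).
Proof.
elim/tensor_ind: u => s; rewrite !tensor_scaleE.
elim: s => [|[x y] s IHs]; first by rewrite tensor_addE.
rewrite /= [LHS]tensor_consE IHs (tensor_consE (c *: x, y)) (tensor_consE (d *: x, y)).
have AC (p q r t : tensor) :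
    tensor_add (tensor_add p q) (tensor_add r t) =
    tensor_add (tensor_add p r) (tensor_add q t).
  by rewrite !tensor_addA -(tensor_addA p q r) (tensor_addC q) (tensor_addA p).
rewrite [RHS]AC; congr tensor_add; rewrite tensor_addE scalerDl.
exact/tensor_ofP/tensor_Dl.
Qed.

Fact tensor_scale0 u : tensor_scale 0 u = tensor_of [::].
Proof.
elim/tensor_ind: u => s; rewrite tensor_scaleE.
elim: s => [//|[x y] s IHs]; rewrite /= tensor_consE IHs tensor_addC tensor_add0.
by rewrite scale0r; apply/tensor_ofP/tensor_0l.
Qed.

Fact tensor_scale1 : left_id 1 tensor_scale.
Proof.
elim/tensor_ind => s; rewrite tensor_scaleE /scale_seq; congr tensor_of.
by rewrite -[RHS]map_id; apply: eq_map => -[x y]; rewrite scale1r.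
Qed.

Definition tensor_opp := tensor_scale (-1).

Fact tensor_addN : left_inverse (tensor_of [::]) tensor_opp tensor_add.
Proof.
by move=> u; rewrite -{2}[u]tensor_scale1 -tensor_scaleDl addNr tensor_scale0.
Qed.

HB.instance Definition _ :=
  GRing.isZmodule.Build tensor tensor_addA tensor_addC tensor_add0 tensor_addN.

Fact tensor_scaleA c d u :
  tensor_scale c (tensor_scale d u) = tensor_scale (c * d) u.
Proof.
elim/tensor_ind: u => s; rewrite !tensor_scaleE /scale_seq -map_comp.
by congr tensor_of; apply: eq_map => -[x y] /=; rewrite scalerA.
Qed.

Fact tensor_scaleDr : right_distributive tensor_scale +%R.
Proof.
move=> c; elim/tensor_ind => s; elim/tensor_ind => t.
by rewrite -![_ + _]/(tensor_add _ _) tensor_addE !tensor_scaleE tensor_addE /scale_seq map_cat.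
Qed.

HB.instance Definition _ := GRing.Zmodule_isLmodule.Build K tensor
  tensor_scaleA tensor_scale1 tensor_scaleDr tensor_scaleDl.

Definition tens (x : X) (y : Y) : tensor := tensor_of [:: (x, y)].

Lemma tensor_ofE s : tensor_of s = \sum_(p <- s) tens p.1 p.2.
Proof.
elim: s => [|[x y] s IHs]; first by rewrite big_nil.
by rewrite big_cons -IHs tensor_consE.
Qed.

Lemma tensP (u : tensor) : exists s, u = \sum_(p <- s) tens p.1 p.2.
Proof. by elim/tensor_ind: u => s; exists s; exact: tensor_ofE. Qed.

Lemma tensDl x x' y : tens (x + x') y = tens x y + tens x' y.
Proof. by rewrite -[RHS]/(tensor_add _ _) tensor_addE; apply/tensor_ofP/tensor_Dl. Qed.

Lemma tensDr x y y' : tens x (y + y') = tens x y + tens x y'.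
Proof. by rewrite -[RHS]/(tensor_add _ _) tensor_addE; apply/tensor_ofP/tensor_Dr. Qed.

Lemma tensZl c x y : tens (c *: x) y = c *: tens x y.
Proof. by rewrite -[RHS]/(tensor_scale _ _) tensor_scaleE. Qed.

Lemma tensZr c x y : tens x (c *: y) = c *: tens x y.
Proof. by rewrite -tensZl; apply/tensor_ofP/tensor_sym/tensor_Z. Qed.

End AlgebraicTensor.

Section Seminorm.
Context {R : realType} {k : scalar_kind}.
Notation K := (scalars R k).

Record seminorm (V : lmodType K) := Seminorm {
  seminorm_fun :> V -> R;
  seminormD : forall u v,
    seminorm_fun (u + v) <= seminorm_fun u + seminorm_fun v;
  seminormZ : forall (c : K) u,
    seminorm_fun (c *: u) = re `|c| * seminorm_fun u }.

Variables (V : lmodType K) (p : seminorm V).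

Lemma seminorm0 : p 0 = 0.
Proof. by rewrite -(scale0r 0) seminormZ normr0 -(@of_real0 R k) of_realK mul0r. Qed.

Lemma seminormN u : p (- u) = p u.
Proof. by rewrite -scaleN1r seminormZ normrN1 -(@of_real1 R k) of_realK mul1r. Qed.

Lemma seminorm_ge0 u : 0 <= p u.
Proof.
have := seminormD p u (- u); rewrite subrr seminorm0 seminormN -mulr2n.
by rewrite pmulrn_lge0.
Qed.

Lemma seminormB u v : p (u - v) = p (v - u).
Proof. by rewrite -opprB seminormN. Qed.

Lemma seminorm_triangle u v w : p (u - w) <= p (u - v) + p (v - w).
Proof.
have -> : u - w = (u - v) + (v - w) by rewrite addrA subrK.
exact: seminormD.
Qed.

Lemma seminorm_lip u v : `|p u - p v| <= p (u - v).
Proof.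
have le a b : p a - p b <= p (a - b).
  by rewrite lerBlDr -{1}(subrK b a); exact: seminormD.
by rewrite ler_norml lerNl opprB seminormB le seminormB le.
Qed.

End Seminorm.

Section ProjectiveNorm.
Context {R : realType} {k : scalar_kind}.
Notation K := (scalars R k).
Variables X Y : normedModType K.
Implicit Types (u v : tensor X Y).

Definition projective_costs u : set R :=
  [set c | exists2 s : seq (X * Y), u = \sum_(p <- s) tens p.1 p.2 &
                                   c = \sum_(p <- s) rnorm p.1 * rnorm p.2].

Definition projective_norm u : R := inf (projective_costs u).

Lemma projective_costs_ge0 u c : projective_costs u c -> 0 <= c.
Proof. by case=> s _ ->; apply: sumr_ge0 => p _; rewrite mulr_ge0// rnorm_ge0. Qed.

Lemma projective_costs_has_inf u : has_inf (projective_costs u).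
Proof.
split; last by exists 0 => c /projective_costs_ge0.
by have [s us] := tensP u; exists (\sum_(p <- s) rnorm p.1 * rnorm p.2), s.
Qed.

Lemma projective_norm_le u c : projective_costs u c -> projective_norm u <= c.
Proof. by apply: ge_inf; case: (projective_costs_has_inf u). Qed.

Lemma projective_norm_ge u r :
  (forall c, projective_costs u c -> r <= c) -> r <= projective_norm u.
Proof. by move=> ?; apply: lb_le_inf => //; case: (projective_costs_has_inf u). Qed.

Fact projective_normD u v :
  projective_norm (u + v) <= projective_norm u + projective_norm v.
Proof.
rewrite -lerBlDr; apply: projective_norm_ge => _ [s us ->].
rewrite lerBlDr -lerBlDl; apply: projective_norm_ge => _ [t vt ->].
rewrite lerBlDl; apply: projective_norm_le; exists (s ++ t).
  by rewrite big_cat /= us vt.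
by rewrite big_cat.
Qed.

Fact projective_normZ (c : K) u :
  projective_norm (c *: u) = re `|c| * projective_norm u.
Proof.
have le b v : projective_norm (b *: v) <= re `|b| * projective_norm v.
  have [->|b0] := eqVneq b 0.
    rewrite normr0 -(@of_real0 R k) of_realK mul0r of_real0 scale0r.
    by apply: projective_norm_le; exists [::]; rewrite big_nil.
  have b1 : 0 < re `|b| by rewrite -(@lt_of_real R k) of_real0 reK// normr_gt0.
  rewrite -ler_pdivrMl//; apply: projective_norm_ge => _ [s vs ->].
  rewrite ler_pdivrMl//; apply: projective_norm_le; exists (scale_seq b s).
    by rewrite vs scaler_sumr big_map; apply: eq_bigr => q _; rewrite tensZl.
  rewrite mulr_sumr big_map; apply: eq_bigr => q _ /=.
  by rewrite rnormZ mulrA.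
have [->|c0] := eqVneq c 0.
  rewrite scale0r normr0 -(@of_real0 R k) of_realK mul0r.
  apply/eqP; rewrite eq_le; apply/andP; split.
    by apply: projective_norm_le; exists [::]; rewrite big_nil.
  by apply: projective_norm_ge => d; exact: projective_costs_ge0.
apply/eqP; rewrite eq_le le /=.
have := le c^-1 (c *: u); rewrite scalerA mulVf // scale1r.
move=> /(ler_wpM2l (@rnorm_ge0 _ _ K^o c)).
rewrite mulrA => /le_trans; apply.
by rewrite -(@reM_real R k) rnormK -normrM mulfV// normr1 -(@of_real1 R k) of_realK mul1r.
Qed.

Definition projective_seminorm : seminorm (tensor X Y) :=
  Seminorm projective_normD projective_normZ.

End ProjectiveNorm.

Section Completion.
Context {R : realType} {k : scalar_kind}.
Notation K := (scalars R k).
Variables (V : lmodType K) (p : seminorm V).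

Definition cauchy_pred : {pred nat -> V} := fun s =>
  `[< forall e : R, 0 < e -> exists N, forall m n,
        (N <= m)%N -> (N <= n)%N -> p (s m - s n) < e >].

(* Completion of a seminormed space: Cauchy sequences modulo sequences whose
   seminorm tends to 0.  It is separated by construction and v |-> [v]
   preserves the seminorm ([rnorm_to_completion]) with dense range
   ([to_completion_dense]), so when p is a norm, as the projective norm is,
   this is its usual completion. *)
Record cauchy_seq :=
  CauchySeq { cauchy_fun :> nat -> V; cauchy_funP : cauchy_fun \in cauchy_pred }.

HB.instance Definition _ := [isSub for cauchy_fun].
HB.instance Definition _ := [Choice of cauchy_seq by <:].

Lemma cauchy_submod_closed : submod_closed cauchy_pred.
Proof.
split=> [|a s t /asboolP sC /asboolP tC]; apply/asboolP => e e0.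
  by exists 0%N => m n _ _; rewrite subrr seminorm0.
pose c := re `|a| + 1.
have c0 : 0 < c by rewrite ltr_wpDl// (@rnorm_ge0 _ _ K^o).
have [|N sN] := sC (e / 2 / c); first by rewrite !divr_gt0.
have [|M tM] := tC (e / 2); first by rewrite divr_gt0.
exists (maxn N M) => m n; rewrite !geq_max => /andP[Nm Mm] /andP[Nn Mn].
have -> : (a *: s + t) m - (a *: s + t) n = a *: (s m - s n) + (t m - t n).
  rewrite -[X in X - _]/(a *: s m + t m) -[X in _ - X]/(a *: s n + t n).
  by rewrite opprD addrACA scalerBr.
apply: le_lt_trans (seminormD _ _ _) _; rewrite seminormZ [e]splitr.
apply: ler_ltD; last exact: tM.
apply: le_trans (_ : c * p (s m - s n) <= _).
  by rewrite ler_wpM2r ?seminorm_ge0// lerDl.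
by rewrite mulrC -ler_pdivlMr// ltW// sN.
Qed.

HB.instance Definition _ :=
  GRing.isSubmodClosed.Build K (nat -> V) cauchy_pred cauchy_submod_closed.
HB.instance Definition _ := [SubChoice_isSubLmodule of cauchy_seq by <:].

Lemma cauchy_seqP (s : cauchy_seq) (e : R) : 0 < e ->
  exists N, forall m n, (N <= m)%N -> (N <= n)%N -> p (s m - s n) < e.
Proof. by have /asboolP := cauchy_funP s; apply. Qed.

Lemma cauchy_const_proof (v : V) : (fun=> v) \in cauchy_pred.
Proof. by apply/asboolP => e e0; exists 0%N => m n _ _; rewrite subrr seminorm0. Qed.

Definition cauchy_const (v : V) : cauchy_seq := CauchySeq (cauchy_const_proof v).

Definition cauchy_norm (s : cauchy_seq) : R := lim (p (s n) @[n --> \oo]).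

Lemma cauchy_norm_cvg (s : cauchy_seq) : p (s n) @[n --> \oo] --> cauchy_norm s.
Proof.
apply: cauchy_cvg; apply/cauchy_ballP => e e0 /=.
have [N sN] := cauchy_seqP s e0.
exists ((p \o s) @` [set n | (N <= n)%N], (p \o s) @` [set n | (N <= n)%N]) => /=.
  by split; exists N => // n /= Nn; exists n.
move=> [_ _] /= [[m Nm <-] [n Nn <-]]; rewrite /ball /=.
exact: le_lt_trans (seminorm_lip _ _ _) (sN _ _ Nm Nn).
Qed.

Arguments cauchy_norm_cvg : clear implicits.

Lemma cauchy_normD s t : cauchy_norm (s + t) <= cauchy_norm s + cauchy_norm t.
Proof.
have stD : p (s n) + p (t n) @[n --> \oo] --> cauchy_norm s + cauchy_norm t.
  exact: cvgD (cauchy_norm_cvg s) (cauchy_norm_cvg t).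
apply: (ler_cvg_to (cauchy_norm_cvg (s + t)) stD).
by near=> n; exact: seminormD.
Unshelve. all: by end_near. Qed.

Lemma cauchy_normZ (c : K) s : cauchy_norm (c *: s) = re `|c| * cauchy_norm s.
Proof.
have cs : re `|c| * p (s n) @[n --> \oo] --> re `|c| * cauchy_norm s.
  by apply: cvgM (cauchy_norm_cvg s); exact: cvg_cst.
have E : (fun n => p ((c *: s) n)) = (fun n => re `|c| * p (s n)).
  by apply/funext => n; exact: seminormZ.
by rewrite {1}/cauchy_norm E; exact: cvg_lim cs.
Qed.

Definition cauchy_seminorm : seminorm cauchy_seq :=
  Seminorm cauchy_normD cauchy_normZ.

Definition cauchy_rel (s t : cauchy_seq) := cauchy_seminorm (s - t) == 0.

Lemma cauchy_rel_refl : reflexive cauchy_rel.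
Proof. by move=> s; rewrite /cauchy_rel subrr seminorm0. Qed.

Lemma cauchy_rel_sym : symmetric cauchy_rel.
Proof. by move=> s t; rewrite /cauchy_rel seminormB. Qed.

Lemma cauchy_rel_trans : transitive cauchy_rel.
Proof.
move=> t s u /eqP st /eqP tu; apply/eqP/eqP.
rewrite eq_le seminorm_ge0 andbT.
by apply: le_trans (seminorm_triangle _ _ t _) _; rewrite st tu addr0.
Qed.

Canonical cauchy_equiv :=
  EquivRel cauchy_rel cauchy_rel_refl cauchy_rel_sym cauchy_rel_trans.

Definition completion := {eq_quot cauchy_equiv}%qT.
HB.instance Definition _ := Choice.on completion.
HB.instance Definition _ := EqQuotient.on completion.

Definition class_of (s : cauchy_seq) : completion := (\pi_completion s)%qT.

Lemma class_ofP s t : class_of s = class_of t <-> cauchy_seminorm (s - t) = 0.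
Proof.
split=> [/eqquotP/eqP //|st].
by apply/eqquotP/eqP.
Qed.

Lemma completion_ind (P : completion -> Prop) :
  (forall s, P (class_of s)) -> forall z, P z.
Proof. by move=> Ps z; rewrite -[z]reprK; exact: Ps. Qed.

Lemma class_repr s : cauchy_seminorm (repr (class_of s) - s) = 0.
Proof. by apply/class_ofP; rewrite /class_of reprK. Qed.

Definition completion_add (y z : completion) := class_of (repr y + repr z).
Definition completion_scale (c : K) (z : completion) := class_of (c *: repr z).

Lemma completion_addE s t :
  completion_add (class_of s) (class_of t) = class_of (s + t).
Proof.
apply/class_ofP/eqP; rewrite eq_le seminorm_ge0 andbT.
by rewrite opprD addrACA (le_trans (seminormD _ _ _))// !class_repr addr0.
Qed.

Lemma completion_scaleE c s :
  completion_scale c (class_of s) = class_of (c *: s).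
Proof. by apply/class_ofP; rewrite -scalerBr seminormZ class_repr mulr0. Qed.

Definition completion_opp := completion_scale (-1).

Fact completion_addA : associative completion_add.
Proof.
elim/completion_ind => s; elim/completion_ind => t; elim/completion_ind => u.
by rewrite !completion_addE addrA.
Qed.

Fact completion_addC : commutative completion_add.
Proof.
elim/completion_ind => s; elim/completion_ind => t.
by rewrite !completion_addE addrC.
Qed.

Fact completion_add0 : left_id (class_of 0) completion_add.
Proof. by elim/completion_ind => s; rewrite completion_addE add0r. Qed.

Fact completion_addN : left_inverse (class_of 0) completion_opp completion_add.
Proof.
elim/completion_ind => s.
by rewrite /completion_opp completion_scaleE completion_addE scaleN1r addNr.
Qed.

HB.instance Definition _ := GRing.isZmodule.Build completion
  completion_addA completion_addC completion_add0 completion_addN.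

Fact completion_scaleA c d z :
  completion_scale c (completion_scale d z) = completion_scale (c * d) z.
Proof. by elim/completion_ind: z => s; rewrite !completion_scaleE scalerA. Qed.

Fact completion_scale1 : left_id 1 completion_scale.
Proof. by elim/completion_ind => s; rewrite completion_scaleE scale1r. Qed.

Fact completion_scaleDr : right_distributive completion_scale +%R.
Proof.
move=> c; elim/completion_ind => s; elim/completion_ind => t.
rewrite -![_ + _]/(completion_add _ _) completion_addE !completion_scaleE.
by rewrite completion_addE scalerDr.
Qed.

Fact completion_scaleDl z :
  {morph completion_scale^~ z : c d / c + d}.
Proof.
move=> c d; elim/completion_ind: z => s; rewrite -[RHS]/(completion_add _ _).
by rewrite !completion_scaleE completion_addE scalerDl.
Qed.

HB.instance Definition _ := GRing.Zmodule_isLmodule.Build K completion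
  completion_scaleA completion_scale1 completion_scaleDr completion_scaleDl.

Fact class_of_linear : linear class_of.
Proof.
move=> c s t; rewrite -[RHS]/(completion_add (completion_scale _ _) _).
by rewrite completion_scaleE completion_addE.
Qed.

HB.instance Definition _ :=
  GRing.isLinear.Build K cauchy_seq completion _ class_of class_of_linear.

Definition completion_norm (z : completion) : R := cauchy_norm (repr z).

Lemma completion_normE s : completion_norm (class_of s) = cauchy_norm s.
Proof.
apply/eqP; rewrite -subr_eq0 -normr_eq0 eq_le normr_ge0 andbT.
apply: le_trans (seminorm_lip cauchy_seminorm _ _) _.
by rewrite class_repr.
Qed.

Let cnorm z : K := of_real (completion_norm z).

Let cnormD y z : cnorm (y + z) <= cnorm y + cnorm z.
Proof.
elim/completion_ind: y => s; elim/completion_ind: z => t.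
rewrite -of_realD le_of_real -linearD !completion_normE; exact: cauchy_normD.
Qed.

Let cnormZ c z : cnorm (c *: z) = `|c| * cnorm z.
Proof.
elim/completion_ind: z => s.
by rewrite /cnorm -linearZ !completion_normE cauchy_normZ of_realM reK.
Qed.

Let cnorm0 z : cnorm z = 0 -> z = 0.
Proof.
elim/completion_ind: z => s /(congr1 re).
rewrite /cnorm of_realK -(@of_real0 R k) of_realK completion_normE => s0.
by rewrite -(linear0 class_of); apply/class_ofP; rewrite subr0.
Qed.

HB.instance Definition _ :=
  Lmodule_isNormed.Build K completion cnormD cnormZ cnorm0.

Definition to_completion (v : V) : completion := class_of (cauchy_const v).

Fact to_completion_linear : linear to_completion.
Proof.
move=> c u v; rewrite /to_completion -linearP; congr class_of.
exact/val_inj.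
Qed.

HB.instance Definition _ :=
  GRing.isLinear.Build K V completion _ to_completion to_completion_linear.

Lemma rnorm_class_of s : rnorm (class_of s) = cauchy_norm s.
Proof. by rewrite -completion_normE; exact: of_realK. Qed.

Lemma rnorm_to_completion v : rnorm (to_completion v) = p v.
Proof.
have pv : (fun=> p v) @ \oo --> p v by exact: cvg_cst.
by rewrite rnorm_class_of; exact: cvg_lim pv.
Qed.

Lemma class_of_approx (s : cauchy_seq) (e : R) : 0 < e ->
  exists N, forall n, (N <= n)%N -> rnorm (class_of s - to_completion (s n)) <= e.
Proof.
move=> e0; have [N sN] := cauchy_seqP s e0; exists N => n Nn.
rewrite /to_completion -linearB rnorm_class_of.
apply: limr_le; first by apply/cvg_ex; exists (cauchy_norm (s - cauchy_const (s n))); exact: cauchy_norm_cvg.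
by exists N => // m /= Nm; apply/ltW; exact: sN.
Qed.

Lemma to_completion_dense (z : completion) (e : R) : 0 < e ->
  exists v, rnorm (z - to_completion v) <= e.
Proof.
elim/completion_ind: z => s /(class_of_approx s)[N sN].
by exists (s N); exact: sN.
Qed.

Lemma completion_complete (F : set_system completion) :
  ProperFilter F -> cauchy F -> cvg F.
Proof.
move=> FF /cauchyP FC.
have FCr (e : R) : 0 < e -> exists z, F [set y | rnorm (z - y) < e].
  move=> e0; have [|z Fz] := FC (of_real e).
    by rewrite -(@of_real0 R k) lt_of_real.
  exists z; apply: filterS Fz => y.
  by rewrite -ball_normE /= -rnormK lt_of_real.
pose d n : R := n.+1%:R^-1.
have d0 n : 0 < d n by rewrite invr_gt0 ltr0n.
pose z n := projT1 (cid (FCr _ (d0 n))).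
have Fz n : F [set y | rnorm (z n - y) < d n] by rewrite /z; case: cid.
pose v n := projT1 (cid (to_completion_dense (z n) (d0 n))).
have zv n : rnorm (z n - to_completion (v n)) <= d n by rewrite /v; case: cid.
have Fv n : F [set y | rnorm (y - to_completion (v n)) < d n + d n].
  apply: filterS (Fz n) => y /= zy.
  have -> : y - to_completion (v n) = (y - z n) + (z n - to_completion (v n)).
    by rewrite addrA subrK.
  apply: le_lt_trans (rnormD _ _) _; apply: ltr_leD (zv n).
  by rewrite /rnorm distrC.
have dsmall (e : R) : 0 < e -> exists N, forall n, (N <= n)%N -> d n < e.
  move=> e0; have [N _ /= dN] := near_infty_natSinv_lt (PosNum e0).
  by exists N => n Nn; exact: dN.
have vC : v \in cauchy_pred.
  apply/asboolP => e e0; have [|N dN] := dsmall (e / 4); first by rewrite divr_gt0.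
  exists N => m n Nm Nn; rewrite -rnorm_to_completion linearB /=.
  have [y [/= ym yn]] := filter_ex (filterI (Fv m) (Fv n)).
  have -> : to_completion (v m) - to_completion (v n) =
      (to_completion (v m) - y) + (y - to_completion (v n)).
    by rewrite addrA subrK.
  apply: le_lt_trans (rnormD _ _) _.
  rewrite {1}/rnorm distrC -/(rnorm _).
  have := dN _ Nm; have := dN _ Nn; lra.
apply/cvg_ex; exists (class_of (CauchySeq vC)).
apply/cvgrPdist_le => e e0.
have re0 : 0 < re e by rewrite -(@lt_of_real R k) of_real0 reK// ltW.
have [|N dN] := dsmall (re e / 4); first by rewrite divr_gt0.
have [|M vM] := @class_of_approx (CauchySeq vC) (re e / 4); first by rewrite divr_gt0.
pose n := maxn N M.
apply: filterS (Fv n) => y /= yn.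
rewrite -rnormK -(reK (ltW e0)) le_of_real.
have -> : class_of (CauchySeq vC) - y =
    (class_of (CauchySeq vC) - to_completion (v n)) + (to_completion (v n) - y).
  by rewrite addrA subrK.
apply: le_trans (rnormD _ _) _.
have /= := vM n (leq_maxr _ _); have := dN n (leq_maxl _ _).
move: yn; rewrite {1}/rnorm distrC -/(rnorm _); lra.
Qed.

HB.instance Definition _ :=
  Uniform_isComplete.Build completion completion_complete.

End Completion.

Section ProjectiveTensor.
Context {R : realType} {k : scalar_kind}.
Notation K := (scalars R k).

Definition projective_tensor (X Y : normedModType K) :
  completeNormedModType K := completion (projective_seminorm X Y).

Definition ptens (X Y : normedModType K) (x : X) (y : Y) :
  projective_tensor X Y := to_completion (projective_seminorm X Y) (tens x y).

End ProjectiveTensor.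

(* Main.v *)
Require Import Defs.
From HB Require Import structures.
From mathcomp Require Import all_boot all_order all_algebra.
From mathcomp Require Import all_classical all_reals all_analysis.
From mathcomp Require Import complex ring lra.

Set Implicit Arguments.
Unset Strict Implicit.
Unset Printing Implicit Defensive.

Import Order.TTheory GRing.Theory Num.Theory.
Import numFieldNormedType.Exports.

Local Open Scope classical_set_scope.
Local Open Scope ring_scope.

(** By Hahn-Banach, a sequence of slices of a unit ball is determining for [a]
    exactly when every half-space [re h > re (h a) - e] contains one of them
    ([SCDP]).  So let [G] be a functional on the projective tensor product,
    that is, a bounded operator [T : X -> dual Y] with
    [T x y = G (ptens x y)]; the task is to find, in a countable family that
    does not depend on [G], a slice on which [re G] is almost at least
    [re (G (ptens a b))].

    Since [b] is a preserved extreme point, the half-spaces that contain [b]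
    cut out a filter base on the ball of [Y] ([half_ballI], a form of
    Choquet's lemma).  Since [T] is compact, one such half-space makes
    [re (T x y)] close to [re (T x b)] for all [x] in the ball at once
    ([compact_half_ball]).  One of the slices determining [b] lies in this
    half-space, and one of the slices determining [a] lies in the half-space
    where [re (T x b)] is almost at least [re (T a b)].  If these two slices
    are given by [g] and [f], then [re G] is almost at least
    [re (G (ptens a b))] on all [ptens x y] with [x] and [y] in them.

    It remains to pass from elementary tensors to a slice of the ball.  If
    [re (f x * g y)] is close to its supremum then, up to a unimodular factor
    moved from [y] to [x], both [x] and [y] are in the given slices
    ([slice_factors]).  Hence for a large constant [C], writing [F] for the
    functional [f (x) g], the bound
    [re (C F - G) <= C * sup (re F) + e - re (G (ptens a b))] holds on all
    elementary tensors of the balls, so on the whole ball, and in a slice of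
    [F] of width small compared with [e / C] it gives the required lower bound for [re G]
    ([tensor_slice]).  The determining family therefore consists of the slices
    of width [1 / (j + 1)] given by the functionals [f_n (x) g_m]. *)

(** * Sublinear functionals and the Hahn-Banach theorem *)

Lemma of_realN {R : realType} {k} (r : R) :
  of_real (- r) = - of_real r :> scalars R k.
Proof. by apply/eqP; rewrite -addr_eq0 -of_realD addNr of_real0. Qed.

Section Sublinear.
Context {R : realType} {k : scalar_kind} (V : lmodType (scalars R k)).
Implicit Types (p q : V -> R) (E : set (V * R)) (u v : V) (r : R).

Definition sublinear p :=
  (forall u v, p (u + v) <= p u + p v) /\
  (forall r v, 0 <= r -> p (of_real r *: v) <= r * p v).

(** Linearity over R, also when [V] is a complex space: such maps are the real
    parts of the linear functionals ([real_part_of]). *)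
Definition real_linear p :=
  (forall u v, p (u + v) = p u + p v) /\
  (forall r v, p (of_real r *: v) = r * p v).

(** A pair [(v, r)] in [E] stands for the requirement that the functional
    looked for be at least [r] at [v]. *)
Definition cone E :=
  [/\ E (0, 0), (forall u r v s, E (u, r) -> E (v, s) -> E (u + v, r + s))
    & forall t u r, 0 <= t -> E (u, r) -> E (of_real t *: u, t * r)].

Lemma sublinear0 p : sublinear p -> p 0 = 0.
Proof.
move=> [pD pZ]; apply/eqP; rewrite eq_le; apply/andP; split.
  by have := pZ 0 0 (lexx _); rewrite scaler0 mul0r.
by have := pD 0 0; rewrite addr0; lra.
Qed.

Lemma sublinearN p u : sublinear p -> - p (- u) <= p u.
Proof.
move=> ps; have := sublinear0 ps; case: ps => pD _.
by have := pD u (- u); rewrite subrr; lra.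
Qed.

Lemma sublinearZ p r u : sublinear p -> 0 <= r -> p (of_real r *: u) = r * p u.
Proof.
move=> ps; have [pD pZ] := ps; rewrite le_eqVlt => /predU1P[<-|r0].
  by rewrite of_real0 scale0r mul0r sublinear0.
apply/eqP; rewrite eq_le pZ ?(ltW r0)//= -ler_pdivlMl//.
have /pZ : 0 <= r^-1 by rewrite invr_ge0 ltW.
move=> /(_ (of_real r *: u)).
by rewrite scalerA -of_realM mulVf ?gt_eqF// of_real1 scale1r.
Qed.

Lemma real_linear0 p : real_linear p -> p 0 = 0.
Proof. by move=> [_ pZ]; have := pZ 0 0; rewrite scaler0 mul0r. Qed.

Lemma real_linearN p u : real_linear p -> p (- u) = - p u.
Proof.
move=> pl; have := real_linear0 pl; have [pD _] := pl.
by have := pD u (- u); rewrite subrr; lra.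
Qed.

Lemma real_linearB p u v : real_linear p -> p (u - v) = p u - p v.
Proof. by move=> pl; have [pD _] := pl; rewrite pD real_linearN. Qed.

(** The new functional is the infimum over [(v, r)] in [E] of
    [p (z + v) - r].  The final bound turns into a lower bound at [v] once the
    functional is odd. *)
Lemma sublinear_shift p E : sublinear p -> cone E ->
  (forall v r, E (v, r) -> r <= p v) ->
  exists q, [/\ sublinear q, forall v, q v <= p v
    & forall v r, E (v, r) -> q (- v) <= - r].
Proof.
move=> ps [E0 ED EZ] Ep; have [pD pZ] := ps.
pose S z := [set p (z + e.1) - e.2 | e in E].
have S_inf z : has_inf (S z).
  split; first by exists (p (z + 0) - 0), (0, 0).
  exists (- p (- z)) => _ [[v r] /= Er <-].
  have := pD (z + v) (- z); rewrite addrAC subrr add0r.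
  have := Ep _ _ Er; lra.
pose q z := inf (S z).
have q_le z v r : E (v, r) -> q z <= p (z + v) - r.
  by move=> Er; apply: ge_inf; [case: (S_inf z)|exists (v, r)].
have q_ge z c : (forall v r, E (v, r) -> c <= p (z + v) - r) -> c <= q z.
  move=> h; apply: lb_le_inf; first by case: (S_inf z).
  by move=> _ [[v r] /= /h hr <-].
exists q; split.
- split.
    move=> u v; rewrite -lerBlDr; apply/q_ge => w r Er.
    rewrite lerBlDr -lerBlDl; apply/q_ge => w' r' Er'; rewrite lerBlDl.
    apply: le_trans (q_le _ _ _ (ED _ _ _ _ Er Er')) _.
    by have := pD (u + w) (v + w'); rewrite addrACA; lra.
  move=> t z; rewrite le_eqVlt => /predU1P[<-|t0].
    rewrite of_real0 scale0r mul0r; apply: le_trans (q_le _ _ _ E0) _.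
    by rewrite addr0 subr0 (sublinear0 ps).
  rewrite -ler_pdivrMl//; apply/q_ge => v r Er; rewrite ler_pdivrMl//.
  apply: le_trans (q_le _ _ _ (EZ _ _ _ (ltW t0) Er)) _.
  by have := pZ t (z + v) (ltW t0); rewrite scalerDr; lra.
- by move=> v; apply: le_trans (q_le _ _ _ E0) _; rewrite addr0 subr0.
- move=> v r Er; apply: le_trans (q_le _ _ _ Er) _.
  by rewrite addNr (sublinear0 ps) sub0r.
Qed.

(** Zorn's lemma: the pointwise infimum of a chain of sublinear functionals
    is sublinear, as it is bounded below by [- p (- v)]. *)
Lemma minimal_sublinear p : sublinear p ->
  exists2 q, sublinear q /\ (forall v, q v <= p v) &
    forall q', sublinear q' -> (forall v, q' v <= q v) -> q' = q.
Proof.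
move=> ps.
pose T := {q | sublinear q /\ forall v, q v <= p v}.
pose below (s t : T) := `[< forall v, sval t v <= sval s v >].
have [||||[q [qs qp]] qmin] := @Zorn T below.
- by move=> t; apply/asboolP.
- move=> r s t /asboolP rs /asboolP st; apply/asboolP => v.
  exact: le_trans (st v) (rs v).
- move=> [s ?] [t ?] /asboolP /= st /asboolP /= ts; apply: eq_exist.
  by apply/funext => v; apply/eqP; rewrite eq_le ts st.
- move=> A Atot; have [->|/set0P[a0 Aa0]] := eqVneq A set0.
    by exists (exist _ p (conj ps (fun=> lexx _))).
  pose S v := [set sval a v | a in A].
  have S_inf v : has_inf (S v).
    split; first by exists (sval a0 v), a0.
    exists (- p (- v)) => _ [[a [/= sa ap]] Aa <-].
    by have := sublinearN v sa; have := ap (- v); lra.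
  pose q v := inf (S v).
  have q_le v a : A a -> q v <= sval a v.
    by move=> Aa; apply: ge_inf; [case: (S_inf v)|exists a].
  have q_ge v c : (forall a, A a -> c <= sval a v) -> c <= q v.
    move=> h; apply: lb_le_inf; first by case: (S_inf v).
    by move=> _ [a /h ha <-].
  have qs : sublinear q.
    split.
      move=> u v; rewrite -lerBlDr; apply/q_ge => a Aa.
      rewrite lerBlDr -lerBlDl; apply/q_ge => b Ab; rewrite lerBlDl.
      have [aD _] := (svalP a).1; have [bD _] := (svalP b).1.
      have [/asboolP ab|/asboolP ba] := Atot _ _ Aa Ab.
        by have := q_le (u + v) b Ab; have := bD u v; have := ab u; lra.
      by have := q_le (u + v) a Aa; have := aD u v; have := ba v; lra.
    move=> t z; rewrite le_eqVlt => /predU1P[<-|t0].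
      rewrite of_real0 scale0r mul0r; apply: le_trans (q_le _ _ Aa0) _.
      by rewrite (sublinear0 (svalP a0).1).
    rewrite -ler_pdivrMl//; apply/q_ge => a Aa; rewrite ler_pdivrMl//.
    apply: le_trans (q_le _ _ Aa) _.
    by have [_ aZ] := (svalP a).1; apply: aZ; exact: ltW.
  have qp v : q v <= p v by apply: le_trans (q_le v _ Aa0) ((svalP a0).2 v).
  exists (exist _ q (conj qs qp)) => a Aa; apply/asboolP => v /=; exact: q_le.
- exists q => // q' q's q'q.
  have q'p v : q' v <= p v by exact: le_trans (q'q v) (qp v).
  apply: (congr1 sval (qmin (exist _ q' (conj q's q'p)) _)).
  exact/asboolP.
Qed.

(** Shifting along the ray of [(u, q u)] cannot make [q] smaller, so [q] is
    odd, and odd sublinear functionals are linear. *)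
Lemma minimal_sublinear_linear q : sublinear q ->
  (forall q', sublinear q' -> (forall v, q' v <= q v) -> q' = q) ->
  real_linear q.
Proof.
move=> qs qmin; have [qD qZ] := qs.
have qN u : q (- u) = - q u.
  pose E : set (V * R) :=
    [set e | exists2 t, 0 <= t & e = (of_real t *: u, t * q u)].
  have EC : cone E.
    split.
    - by exists 0; rewrite // of_real0 scale0r mul0r.
    - move=> _ _ _ _ [s s0 [-> ->]] [t t0 [-> ->]].
      exists (s + t); first exact: addr_ge0.
      by rewrite of_realD scalerDl mulrDl.
    - move=> t _ _ t0 [s s0 [-> ->]]; exists (t * s); first exact: mulr_ge0.
      by rewrite of_realM scalerA mulrA.
  have [|q' [q's q'q q'E]] := sublinear_shift qs EC.
    by move=> _ _ [t t0 [-> ->]]; rewrite sublinearZ.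
  have := q'E u (q u); rewrite (qmin _ q's q'q) => h.
  apply/eqP; rewrite eq_le h /=; last by exists 1; rewrite // of_real1 scale1r mul1r.
  by have := sublinearN u qs; lra.
split=> [u v|r v].
  apply/eqP; rewrite eq_le qD /=.
  by have := qD (u + v) (- v); rewrite addrK qN; lra.
have [r0|r0] := leP 0 r; first exact: sublinearZ.
rewrite -[r]opprK of_realN scaleNr qN sublinearZ ?mulNr// oppr_ge0 ltW//.
Qed.

(** The extension form (take for [E] the graph of a linear functional on a
    subspace) and the separation form are both instances. *)
Theorem hahn_banach p E : sublinear p -> cone E ->
  (forall v r, E (v, r) -> r <= p v) ->
  exists phi, [/\ real_linear phi, forall v, phi v <= p v
    & forall v r, E (v, r) -> r <= phi v].
Proof.
move=> ps EC Ep; have [q [qs qp qE]] := sublinear_shift ps EC Ep.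
have [phi [phis phiq] phimin] := minimal_sublinear qs.
have phil := minimal_sublinear_linear phis phimin.
exists phi; split=> // [v|v r Er]; first exact: le_trans (phiq v) (qp v).
by have := qE v r Er; have := phiq (- v); rewrite real_linearN//; lra.
Qed.
End Sublinear.

(** * Real and complex functionals *)

Section ScalarFacts.
Context {R : realType} {k : scalar_kind}.
Notation K := (scalars R k).
Implicit Types (c : K).

Lemma re0 : re (0 : K) = 0.
Proof. by rewrite -(@of_real0 R k) of_realK. Qed.

Lemma re_of_real_norm (r : R) : re `|of_real r : K| = `|r|.
Proof.
rewrite /of_real /re; case: k => //=.
by rewrite expr0n /= addr0 sqrtr_sqr.
Qed.

Lemma re_rot c : exists2 t : K, re `|t| = 1 & t * c = `|c|.
Proof.
have [->|c0] := eqVneq c 0.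
  by exists 1; rewrite ?mulr0 ?normr0// normr1 -(@of_real1 R k) of_realK.
exists (`|c| / c); last by rewrite divfK.
by rewrite normrM normfV normr_id mulfV ?normr_eq0// -(@of_real1 R k) of_realK.
Qed.

(** The imaginary unit serves in the complex case, and 0 in the real case.  It
    reduces estimates and limits of scalars to those of real parts. *)
Lemma norm_le_re_parts :
  exists2 j : K, re `|j| <= 1 & forall c, re `|c| <= `|re c| + `|re (j * c)|.
Proof.
rewrite /re; case: k => /=.
  by exists 0 => [|c]; rewrite ?mul0r normr0 ?addr0 ?ler01.
exists 'i%C => [|[x y]] /=; first by rewrite expr0n expr1n add0r sqrtr1.
rewrite mul0r mul1r sub0r normrN.
have -> : `|x| + `|y| = Num.sqrt ((`|x| + `|y|) ^+ 2).
  by rewrite sqrtr_sqr [RHS]ger0_norm// addr_ge0.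
rewrite ler_wsqrtr// sqrrD !real_normK ?num_real//.
by rewrite -addrA [_ *+ 2 + _]addrC addrA lerDl mulrn_wge0// mulr_ge0.
Qed.
End ScalarFacts.

Section Complexify.
Context {R : realType} {k : scalar_kind}.
Notation K := (scalars R k).
Variable V : normedModType K.

Lemma bounded_linear_dual (f : V -> K) (C : R) : linear (f : V -> K^o) ->
  (forall v, re `|f v| <= C * rnorm v) -> (f : V -> K^o) \in @dual_pred R k V.
Proof.
move=> fl fC; apply/asboolP; split => //.
pose F : {linear V -> K^o} := HB.pack (f : V -> K^o)
  (GRing.isLinear.Build K V K^o _ (f : V -> K^o) fl).
apply: (@bounded_linear_continuous _ _ _ F).
apply/bounded_funP => r; exists (of_real (`|C| * re r)) => x xr.
rewrite -[leLHS]reK// le_of_real; apply: le_trans (fC x) _.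
apply: le_trans (_ : `|C| * rnorm x <= _).
  by rewrite ler_wpM2r ?rnorm_ge0 ?ler_norm.
by rewrite ler_wpM2l// le_re.
Qed.

(** In the complex case, [v |-> phi v - i phi (i v)]. *)
Lemma real_part_of (phi : V -> R) : real_linear phi ->
  exists2 f : V -> K^o, linear f & forall v, re (f v) = phi v.
Proof.
move=> phil.
have phi0 := real_linear0 phil.
have phiN u := real_linearN u phil.
case: phil => phiD phiZ.
move: phi0 phiN phiD phiZ.
rewrite /re /of_real; case: k V phi => /= W psi psi0 psiN psiD psiZ.
  by exists psi => // c u v; rewrite psiD psiZ.
exists (fun v => (psi v +i* - psi ('i%C *: v))%C) => //.
move=> [x y] u v.
have iZ w : ((x +i* y)%C : R[i]) *: w =
    ((x +i* 0)%C : R[i]) *: w + ((y +i* 0)%C : R[i]) *: ('i%C *: w).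
  rewrite scalerA -scalerDl; congr (_ *: _).
  by apply/eqP; rewrite eq_complex /=; apply/andP; split; apply/eqP; ring.
have iiZ w : ('i%C : R[i]) *: ('i%C *: w) = - w.
  by rewrite scalerA -expr2 sqr_i scaleN1r.
have ixZ w : ('i%C : R[i]) *: (((x +i* y)%C : R[i]) *: w) =
    ((x +i* y)%C : R[i]) *: ('i%C *: w).
  by rewrite !scalerA mulrC.
apply/eqP; rewrite eq_complex /= scalerDr ixZ !psiD !iZ !psiD !psiZ iiZ psiN.
by apply/andP; split; apply/eqP; ring.
Qed.

Lemma complexify (phi : V -> R) (C : R) : real_linear phi ->
  (forall v, phi v <= C * rnorm v) ->
  exists g : dual V, forall v, re (g v) = phi v.
Proof.
move=> phil phiC.
have phi_norm v : `|phi v| <= `|C| * rnorm v.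
  have h u : phi u <= `|C| * rnorm u.
    by apply: le_trans (phiC u) _; rewrite ler_wpM2r ?rnorm_ge0 ?ler_norm.
  rewrite ler_norml h andbT lerNl -(real_linearN v phil).
  by have := h (- v); rewrite /rnorm normrN.
have [f fl fr] := real_part_of phil; have [j j1 jn] := @norm_le_re_parts R k.
suff fC v : re `|f v| <= (`|C| + `|C|) * rnorm v.
  by exists (Dual (bounded_linear_dual fl fC)).
apply: le_trans (jn _) _; rewrite mulrDl; apply: lerD; first by rewrite fr.
have f0 : f 0 = 0 by have := fl (-1) 0 0; rewrite scaler0 addr0 scaleN1r addNr.
have -> : j * f v = f (j *: v) by have := fl j v 0; rewrite f0 !addr0 => ->.
rewrite fr; apply: le_trans (phi_norm _) _; rewrite ler_wpM2l// rnormZ.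
by rewrite ler_piMl ?rnorm_ge0.
Qed.
End Complexify.

(** * Slices of the unit ball, separation and SCD points *)

Section DualNorm.
Context {R : realType} {k : scalar_kind} {V : normedModType (scalars R k)}.
Implicit Types (f g h : dual V) (x y : V) (A D : set V).

Lemma re_dualB f x y : re (f (x - y)) = re (f x) - re (f y).
Proof. by rewrite linearB reD reN. Qed.

Lemma re_dual_bound f x : `|re (f x)| <= dual_norm f * rnorm x.
Proof. exact: le_trans (re_norm_le _) (dual_bound f x). Qed.

Lemma re_dual_le f x : unit_ball x -> `|re (f x)| <= dual_norm f.
Proof. by move=> x1; apply: le_trans (re_norm_le _) (dual_norm_ge f x1). Qed.

Lemma unit_ball0 : (unit_ball : set V) 0.
Proof. by rewrite /unit_ball /= normr0. Qed.

Lemma unit_ball_rot (t : scalars R k) x :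
  re `|t| = 1 -> unit_ball x -> unit_ball (t *: x).
Proof.
by move=> t1 /unit_ballE x1; apply/unit_ballE; rewrite rnormZ t1 mul1r. Qed.

Lemma unit_ball_polar x : exists2 y, unit_ball y & x = of_real (rnorm x) *: y.
Proof.
have [->|x0] := eqVneq x 0; first by exists 0; rewrite ?scaler0//; exact: unit_ball0.
have nx0 : `|x| != 0 by rewrite normr_eq0.
exists (`|x|^-1 *: x); first by rewrite /unit_ball /= normrZ normfV normr_id mulVf.
by rewrite rnormK scalerA mulfV// scale1r.
Qed.

(** The ball is stable under unimodular scalars, which turn [re (f x)] into
    [`|f x|]. *)
Lemma dual_norm_re_le f (c : R) :
  (forall x, unit_ball x -> re (f x) <= c) -> dual_norm f <= c.
Proof.
move=> fc; apply: dual_norm_le => x x1.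
have [t t1 tE] := re_rot (f x); rewrite /rnorm -tE.
have -> : t * f x = f (t *: x) by rewrite linearZ.
exact/fc/unit_ball_rot.
Qed.

Lemma sup_re_unit_ball f : sup [set re (f x) | x in unit_ball] = dual_norm f.
Proof.
have S_sup : has_sup [set re (f x) | x in unit_ball].
  split; first by exists (re (f 0)), 0; rewrite //; exact: unit_ball0.
  by exists (dual_norm f) => _ [x /(re_dual_le f) fx <-]; exact: le_trans (ler_norm _) fx.
apply/eqP; rewrite eq_le; apply/andP; split.
  apply: ge_sup; first by case: S_sup.
  by move=> _ [x /(re_dual_le f) fx <-]; exact: le_trans (ler_norm _) fx.
by apply: dual_norm_re_le => x x1; apply: sup_ubound; [case: S_sup|exists x].
Qed.

Lemma dual_re_ext f g : (forall x, re (f x) = re (g x)) -> f = g.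
Proof.
move=> fg; apply/eqP; rewrite -subr_eq0; apply/eqP/dual_norm_eq0/eqP.
rewrite eq_le dual_norm_ge0 andbT; apply: dual_norm_re_le => x _.
by rewrite -[(f - g) x]/(f x - g x) reD reN fg subrr.
Qed.

Lemma slice_unit_ballE f (alpha : R) x :
  slice unit_ball f alpha x <-> unit_ball x /\ dual_norm f - alpha < re (f x).
Proof. by rewrite /slice /= sup_re_unit_ball. Qed.

Lemma slice_neq0 f (alpha : R) : 0 < alpha -> slice unit_ball f alpha !=set0.
Proof.
move=> a0; apply: contrapT => nS.
have : dual_norm f <= dual_norm f - alpha.
  apply: dual_norm_re_le => x x1; rewrite leNgt; apply/negP => fx; apply: nS.
  by exists x; apply/slice_unit_ballE.
lra.
Qed.

Definition real_convex D := forall x y (t : R), D x -> D y -> 0 <= t <= 1 ->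
  D (of_real t *: x + of_real (1 - t) *: y).

(** Apply the Hahn-Banach theorem to the norm and to the cone of the
    [(t (x - d), t r)] with [0 <= t] and [d] in [D]: convexity of [D] is what
    makes this cone closed under addition. *)
Lemma separation D x (r : R) : D !=set0 -> real_convex D -> 0 < r ->
  (forall d, D d -> r <= rnorm (x - d)) ->
  exists g, forall d, D d -> re (g d) <= re (g x) - r.
Proof.
move=> [d0 Dd0] Dc r0 Dr.
pose p (v : V) := rnorm v.
have ps : sublinear p.
  split=> [u v|t v t0]; first exact: rnormD.
  by rewrite /p rnormZ re_of_real_norm ger0_norm.
pose E : set (V * R) := [set e | exists t, 0 <= t /\
  exists d, D d /\ e = (of_real t *: (x - d), t * r)].
have EC : cone E.
  split.
  - by exists 0; split=> //; exists d0; rewrite of_real0 scale0r mul0r.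
  - move=> _ _ _ _ [s [s0 [d [Dd [-> ->]]]]] [t [t0 [e [De [-> ->]]]]].
    exists (s + t); split; first exact: addr_ge0.
    have [st0|st0] := eqVneq (s + t) 0.
      have [-> ->] : s = 0 /\ t = 0 by split; lra.
      by exists d; split=> //; rewrite !(addr0, mul0r, of_real0, scale0r).
    have st_gt0 : 0 < s + t by rewrite lt_neqAle eq_sym st0 addr_ge0.
    exists (of_real (s / (s + t)) *: d + of_real (1 - s / (s + t)) *: e); split.
      apply: Dc => //; rewrite divr_ge0 ?addr_ge0//=.
      by rewrite ler_pdivrMr// mul1r lerDl.
    rewrite mulrDl; congr (_, _).
    have -> : 1 - s / (s + t) = t / (s + t) by field.
    rewrite [RHS]scalerBr [in RHS]scalerDr !scalerA -!of_realM !mulrA.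
    rewrite ![(s + t) * _]mulrC !mulfK//.
    by rewrite of_realD scalerDl !scalerBr opprD addrACA.
  - move=> t _ _ t0 [s [s0 [d [Dd [-> ->]]]]]; exists (t * s).
    split; first exact: mulr_ge0.
    by exists d; rewrite of_realM scalerA mulrA.
have [|phi [phil phip phiE]] := hahn_banach ps EC.
  move=> _ _ [t [t0 [d [Dd [-> ->]]]]]; rewrite sublinearZ//.
  by rewrite ler_wpM2l// Dr.
have [|g gphi] := @complexify _ _ _ phi 1 phil.
  by move=> v; rewrite mul1r; exact: phip.
exists g => d Dd; rewrite !gphi.
have := phiE (x - d) r; rewrite real_linearB// => h.
have {}h : r <= phi x - phi d.
  apply: h; exists 1; split; first exact: ler01.
  by exists d; rewrite of_real1 scale1r mul1r.
lra.
Qed.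

Lemma closure_rnormP A x :
  closure A x <-> forall r : R, 0 < r -> exists2 d, A d & rnorm (x - d) < r.
Proof.
split=> [clx r r0|h U /nbhs_normP[e /= e0 eU]].
  have [|d [Ad]] := clx [set y | rnorm (x - y) < r]; last by exists d.
  apply/nbhs_normP; exists (of_real r) => /=.
    by rewrite -(@of_real0 R k) lt_of_real.
  by move=> y /=; rewrite -rnormK lt_of_real.
have e0' : 0 < re e by rewrite -(@lt_of_real R k) of_real0 reK// ltW.
have [d Ad xd] := h _ e0'; exists d; split=> //; apply: eU => /=.
by rewrite -rnormK -(reK (ltW e0)) lt_of_real.
Qed.

Lemma conv_hull_convex A : real_convex (conv_hull A).
Proof.
move=> x y t Ax Ay /andP[t0 t1].
have T0 : 0 <= (of_real t : scalars R k) by rewrite -(@of_real0 R k) le_of_real.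
have T1 : (of_real t : scalars R k) <= 1 by rewrite -(@of_real1 R k) le_of_real.
move=> C [Cc AC].
have Cx := Ax C (conj Cc AC); have Cy := Ay C (conj Cc AC).
have /= := Cc x y (Itv01 T0 T1) (mem_set Cx) (mem_set Cy).
rewrite inE => h.
by rewrite of_realD of_realN of_real1.
Qed.

Lemma conv_hull_re_le A g (c : R) : (forall x, A x -> re (g x) <= c) ->
  forall x, closure (conv_hull A) x -> re (g x) <= c.
Proof.
move=> Ac x clx.
have hc y : conv_hull A y -> re (g y) <= c.
  apply: (@smallest_sub _ _ _ [set y | re (g y) <= c]) => // u v l.
  rewrite !inE /= => gu gv.
  rewrite -[conv _ _ _]/(l%:num *: u + (1 - l%:num) *: v).
  have l0 : 0 <= l%:num by [].
  have l1 : l%:num <= 1 by [].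
  rewrite -(reK l0) -(@of_real1 R k) -of_realN -of_realD.
  move: (le_re l0) (le_re l1); rewrite -{1}(@of_real0 R k) -{1}(@of_real1 R k) !of_realK.
  move: (re _) => s s0 s1; rewrite linearD !linearZ /= reD !reM_real.
  apply: le_trans (_ : s * c + (1 - s) * c <= _).
    by rewrite lerD// ler_wpM2l// subr_ge0.
  by rewrite -mulrDl addrC subrK mul1r.
apply/ler_addgt0Pr => e e0.
have n0 : 0 < dual_norm g + 1 by rewrite ltr_wpDl// dual_norm_ge0.
have [|y /hc gy xy] := (closure_rnormP _ _).1 clx (e / (dual_norm g + 1)).
  exact: divr_gt0.
have := re_dual_bound g (x - y); rewrite re_dualB => /(le_trans (ler_norm _)).
have : dual_norm g * rnorm (x - y) <= e.
  apply: le_trans (_ : (dual_norm g + 1) * rnorm (x - y) <= _).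
    by rewrite ler_wpM2r ?rnorm_ge0// lerDl.
  by rewrite mulrC -ler_pdivlMr// ltW.
lra.
Qed.

Lemma not_conv_hull_separation A x : A !=set0 -> ~ closure (conv_hull A) x ->
  exists g, exists2 r : R, 0 < r & forall d, A d -> re (g d) <= re (g x) - r.
Proof.
move=> [d0 Ad0] /(closure_rnormP _ _) /existsNP[r /not_implyP[r0 Ar]].
have subA : A `<=` conv_hull A by exact: sub_gen_smallest.
have [|||d Ad|g gA] := @separation (conv_hull A) x r.
- by exists d0; exact: subA.
- exact: conv_hull_convex.
- exact: r0.
- by rewrite leNgt; apply/negP => ?; apply: Ar; exists d.
- by exists g, r => // d /subA; exact: gA.
Qed.

(** If no [W n] lies in the half-space at [x] given by [h] and [e], a choice
    of points outside it meets all [W n], yet its closed convex hull misses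
    [x]; the converse is separation. *)
Lemma SCDP x : SCD unit_ball x <->
  unit_ball x /\ exists (f : nat -> dual V) (alpha : nat -> R),
    (forall n, 0 < alpha n) /\
    forall h (e : R), 0 < e ->
      exists n, forall y, slice unit_ball (f n) (alpha n) y ->
        re (h x) - e < re (h y).
Proof.
split=> [[x1 [W [Wslice [_ Wdet]]]]|[x1 [f [alpha [a0 fP]]]]]; split=> //.
  have [f fP] := choice (fun n => (Wslice n).2).
  have [alpha aP] := choice fP.
  exists f, alpha; split=> [n|h e e0]; first by case: (aP n).
  apply: contrapT => /forallNP nn.
  have bad n : exists y, W n y /\ re (h y) <= re (h x) - e.
    apply: contrapT => /forallNP ny; apply: (nn n) => y.
    rewrite -(aP n).2 => Wy; rewrite ltNge; apply/negP => hy.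
    by apply: (ny y).
  have [y yP] := choice bad.
  have : re (h x) <= re (h x) - e; last lra.
  apply: (@conv_hull_re_le (range y)).
    by move=> _ [n _ <-]; exact: (yP n).2.
  apply: Wdet.
    by move=> _ [n _ <-]; have := (yP n).1; rewrite (aP n).2 => -[].
  by move=> n; exists (y n); split; [exists n|exact: (yP n).1].
exists (fun n => slice unit_ball (f n) (alpha n)).
have S0 n := slice_neq0 (f n) (a0 n).
split; first by move=> n; split=> //; exists (f n), (alpha n).
split=> [n|B BA BV]; first by split=> // y [].
apply: contrapT => /not_conv_hull_separation[|h [r r0 hB]].
  by have [b [Bb _]] := BV 0%N; exists b.
have [n nP] := fP h r r0; have [b [Bb /nP]] := BV n.
by have := hB b Bb; lra.
Qed.

End DualNorm.

(** * Preserved extreme points and half-spaces *)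

Lemma ultra_bounded_cvg (R : realType) (I : Type) (G : set_system I)
    (u : I -> R) (c : R) :
  UltraFilter G -> (forall i, `|u i| <= c) -> exists l : R, u i @[i --> G] --> l.
Proof.
move=> GU uc.
have Gc : (u i @[i --> G]) `[- c, c]%classic.
  apply: (@filterE _ G) => i; rewrite /= in_itv /= -ler_norml; exact: uc.
have [l [_ lcl]] := @segment_compact R (- c) c _ _ Gc.
exists l => U lU.
have [//|GnU] := in_ultra_setVsetC (u @^-1` U) GU.
by have [x [nUx Ux]] := lcl (~` U) U GnU lU.
Qed.

Section WeakStarLimit.
Context {R : realType} {k : scalar_kind} {V : normedModType (scalars R k)}.
Context {I : Type} (G : set_system I) {GU : UltraFilter G}.

(** A direct form of the weak* compactness of the bidual ball: the limits of
    the [re (f (v i))] are the real parts of an element of the bidual. *)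
Lemma weak_star_limit (v : I -> V) : (forall i, unit_ball (v i)) ->
  exists2 x : dual (dual V),
    weak_star_closure (@to_bidual R k V @` unit_ball) x &
    forall f : dual V, re (f (v i)) @[i --> G] --> re (x f).
Proof.
move=> v1.
have fvP (f : dual V) : exists l : R, re (f (v i)) @[i --> G] --> l.
  have := @ultra_bounded_cvg _ _ G (fun i => re (f (v i))) (dual_norm f) GU.
  by apply=> i; exact: re_dual_le.
have [phi phiP] := choice fvP.
have uniq (u : I -> R) (l l' : R) : u @ G --> l -> u @ G --> l' -> l = l'.
  by move=> ul ul'; apply: (cvg_unique _ ul ul').
have phil : real_linear phi.
  split=> [f g|r f].
    apply: (uniq _ _ _ (phiP (f + g))).
    rewrite (_ : (fun i => _) = (fun i => re (f (v i)) + re (g (v i)))).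
      exact: cvgD.
    by apply/funext => i; rewrite -reD.
  apply: (uniq _ _ _ (phiP (of_real r *: f))).
  rewrite (_ : (fun i => _) = (fun i => r * re (f (v i)))).
    by apply: cvgM; [exact: cvg_cst|exact: phiP].
  by apply/funext => i; rewrite -reM_real.
have phi1 f : phi f <= 1 * rnorm f.
  rewrite mul1r dual_rnormE.
  apply: (cvgr_to_le (phiP f)).
  by apply: filterE => i; apply: le_trans (ler_norm _) (re_dual_le _ (v1 i)).
have [x xphi] := complexify phil phi1.
have xP (f : dual V) : re (f (v i)) @[i --> G] --> re (x f) by rewrite xphi.
exists x => //.
rewrite /weak_star_closure closureEcvg.
exists ((fun i => to_bidual (v i)) @ G); first exact: fmap_proper_filter.
split.
  have [j j1 jP] := @norm_le_re_parts R k.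
  pose K1 := (scalars R k)^o.
  have ptwsx : {ptws, ((fun i => (to_bidual (v i) : dual V -> K1)) @ G) -->
      (x : dual V -> K1)}.
    apply/pointwise_cvgP => f.
    apply/cvgrPdist_lt => e e0.
    have e0' : 0 < re e / 2 by rewrite divr_gt0// -(@lt_of_real R k) of_real0 reK// ltW.
    have near_re (h : dual V) : \forall i \near G, `|re (x h) - re (h (v i))| < re e / 2.
      by have /cvgrPdist_lt := xP h; exact.
    have nf := near_re f; have njf := near_re (j *: f).
    suff : \forall i \near G, `|x f - f (v i)| < e by [].
    apply: filterS2 nf njf => i /= fi jfi.
    rewrite -(reK (ltW e0)) -rnormK lt_of_real.
    apply: le_lt_trans (jP _) _; rewrite [ltRHS]splitr ltrD//; first by rewrite reD reN.
    move: jfi; rewrite linearZ /=.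
    by rewrite mulrBr reD reN.
  move=> U; rewrite nbhsE => -[_ [[A Aop <-] Ax] AU].
  apply: filterS AU _.
  by apply: (ptwsx A); exact: open_nbhs_nbhs.
move=> A AB; apply: (@filterE _ G) => i; by apply: AB; exists (v i).
Qed.

(** The hypotheses say that [u i] is [m i] times a point of the ball on which
    [re g] is at most [c], the vertex [0] of the cone standing for
    [m i = 0]. *)
Lemma scaled_limit (g : dual V) (c : R) (m : I -> R) (u : I -> V) :
  (forall i, [/\ 0 <= m i, m i <= 1, rnorm (u i) <= m i
    & re (g (u i)) <= m i * c]) ->
  exists (l : R) (x : dual (dual V)),
  [/\ m @ G --> l,
    weak_star_closure (@to_bidual R k V @` unit_ball) x,
    forall f : dual V, re (f (u i)) @[i --> G] --> l * re (x f)
    & 0 < l -> re (x g) <= c].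
Proof.
move=> mP.
have [l ml] : exists l : R, m @ G --> l.
  apply: (@ultra_bounded_cvg _ _ G m 1) => i.
  by have [m0 m1 _ _] := mP i; rewrite ger0_norm.
pose v i := of_real (m i)^-1 *: u i.
have uE i : u i = of_real (m i) *: v i.
  rewrite /v scalerA -of_realM; have [m0 _ um _] := mP i.
  have [mi0|mi0] := eqVneq (m i) 0; last by rewrite mulfV// of_real1 scale1r.
  rewrite mi0 mul0r of_real0 scale0r; apply: rnorm0_eq0.
  by apply/eqP; rewrite eq_le rnorm_ge0 -mi0 um.
have v1 i : unit_ball (v i).
  have [m0 _ um _] := mP i; apply/unit_ballE.
  rewrite rnormZ re_of_real_norm ger0_norm ?invr_ge0//.
  move: m0; rewrite le_eqVlt => /predU1P[<-|m0]; first by rewrite invr0 mul0r.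
  by rewrite ler_pdivrMl// mulr1.
have [x xcl xP] := weak_star_limit v1.
exists l, x; split=> // [f|l0].
  rewrite (_ : (fun i => _) = (fun i => m i * re (f (v i)))); first exact: cvgM.
  by apply/funext => i; rewrite {1}uE linearZ /= reM_real.
apply: (cvgr_to_le (xP g)).
have /cvgr_gt/(_ _ l0) := ml.
apply: filterS => i /= mi0; have [_ _ _ gu] := mP i.
by rewrite /v linearZ /= reM_real ler_pdivrMl.
Qed.
End WeakStarLimit.

Section ExtremePoint.
Context {R : realType} {k : scalar_kind} {V : normedModType (scalars R k)}.
Implicit Types (g : dual V) (x b : V).

(** The width [d] is measured from [re (g b)], not from the supremum of [re g]
    as for slices, so that a point [b] of the ball belongs to it when
    [0 < d]. *)
Definition half_ball b g (d : R) : set V :=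
  [set x | unit_ball x /\ re (g b) - d < re (g x)].

(** Let [D] be the convex hull of the points of the ball that are missing from
    one of the two half-balls.  If [b] is not in the closure of [D], a
    functional separating [b] from [D] gives the half-ball.  Otherwise [b] is
    a limit of convex combinations [m y1 + (1 - m) y2] with [y1] outside the
    first half-ball and [y2] outside the second; along an ultrafilter this
    writes [to_bidual b] as a convex combination of two points of the weak*
    closure, each of them kept away from it by [g1] or [g2] as soon as its
    weight is positive, against extremality. *)
Lemma half_ballI b :
  extreme_point (weak_star_closure (@to_bidual R k V @` unit_ball))
    (to_bidual b) ->
  forall g1 g2 (d1 d2 : R), 0 < d1 -> 0 < d2 ->
  exists g, exists2 d : R, 0 < d &
    half_ball b g d `<=` half_ball b g1 d1 `&` half_ball b g2 d2.
Proof.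
move=> [_ bext] g1 g2 d1 d2 d1_gt0 d2_gt0.
(* The points [m y] with [y] in the ball and [re (g y) <= c], described without
   dividing by [m]: this makes the convexity of [D] a linear computation. *)
pose P (g : dual V) (c m : R) (u : V) :=
  [/\ 0 <= m, m <= 1, rnorm u <= m & re (g u) <= m * c].
pose c1 := re (g1 b) - d1; pose c2 := re (g2 b) - d2.
pose D : set V := [set y | exists u, exists m,
  P g1 c1 m u.1 /\ P g2 c2 (1 - m) u.2 /\ y = u.1 + u.2].
have P0 g c : P g c 0 0.
  by split; rewrite ?rnorm0 ?linear0 ?mul0r ?ler01 // -(@of_real0 R k) of_realK.
have Pball g c y : unit_ball y -> re (g y) <= c -> P g c 1 y.
  by move=> /unit_ballE y1 gy; split; rewrite ?ler01 ?mul1r.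
have PC g c m n u v (t : R) : P g c m u -> P g c n v -> 0 <= t <= 1 ->
    P g c (t * m + (1 - t) * n) (of_real t *: u + of_real (1 - t) *: v).
  move=> [m0 m1 um gu] [n0 n1 vn gv] /andP[t0 t1].
  have t1' : 0 <= 1 - t by rewrite subr_ge0.
  split.
  - by rewrite addr_ge0// mulr_ge0.
  - have := ler_wpM2l t0 m1; have := ler_wpM2l t1' n1; lra.
  - apply: le_trans (rnormD _ _) _; rewrite !rnormZ !re_of_real_norm !ger0_norm//.
    by rewrite lerD// ler_wpM2l.
  - rewrite linearD !linearZ /= reD !reM_real [leRHS]mulrDl -!mulrA.
    by rewrite lerD// ler_wpM2l.
have Dc : real_convex D.
  move=> _ _ t [[u1 u2] [m [/= Pu1 [Pu2 ->]]]] [[v1 v2] [n [/= Pv1 [Pv2 ->]]]] t01.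
  exists (of_real t *: u1 + of_real (1 - t) *: v1,
          of_real t *: u2 + of_real (1 - t) *: v2).
  exists (t * m + (1 - t) * n); split; first exact: PC.
  split; last by rewrite /= !scalerDr addrACA.
  have -> : 1 - (t * m + (1 - t) * n) = t * (1 - m) + (1 - t) * (1 - n) by ring.
  exact: PC.
have DU y : unit_ball y -> ~ D y -> half_ball b g1 d1 y /\ half_ball b g2 d2 y.
  move=> y1 nDy; split; split=> //; rewrite ltNge; apply/negP => gy; apply: nDy.
    exists (y, 0), 1; split; first exact: Pball.
    by rewrite subrr addr0; split=> //; exact: P0.
  exists (0, y), 0; split; first exact: P0.
  by rewrite subr0 add0r; split=> //; exact: Pball.
have [|] := pselect (closure D b); last first.
  move=> /(closure_rnormP _ _) /existsNP[r /not_implyP[r0 Dr]].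
  have [D0|/set0P D0] := eqVneq D set0.
    exists g1, d1 => // y [y1 _]; apply: DU => //; by rewrite D0.
  have [|g gD] := separation D0 Dc r0 (x := b).
    by move=> d Dd; rewrite leNgt; apply/negP => ?; apply: Dr; exists d.
  exists g, r => // y [y1 gy]; apply: DU => // /gD.
  lra.
move=> /closure_rnormP clD; exfalso.
have /choice[um umP] (n : nat) : exists um : (V * V) * R, [/\ P g1 c1 um.2 um.1.1,
    P g2 c2 (1 - um.2) um.1.2 & rnorm (b - (um.1.1 + um.1.2)) < n.+1%:R^-1].
  have [|_ [u [m [Pu1 [Pu2 ->]]]] bu] := clD n.+1%:R^-1; first by rewrite invr_gt0.
  by exists (u, m).
have [G [GU GF]] := @ultraFilterLemma nat \oo _.
have [n|l [x1 [ml x1cl x1P x1g]]] :=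
  @scaled_limit _ _ _ _ G GU g1 c1 (fun n => (um n).2) (fun n => (um n).1.1).
  by case: (umP n).
have [n|l' [x2 [ml' x2cl x2P x2g]]] :=
  @scaled_limit _ _ _ _ G GU g2 c2 (fun n => 1 - (um n).2) (fun n => (um n).1.2).
  by case: (umP n).
have l'E : l' = 1 - l.
  by apply: (cvg_unique _ ml' (cvgB (cvg_cst (1 : R)) ml)).
have l0 : 0 <= l.
  by apply: (cvgr_to_ge ml); apply: (@filterE _ G) => n; case: (umP n) => -[].
have l1 : 0 <= 1 - l.
  rewrite -l'E; apply: (cvgr_to_ge ml'); apply: (@filterE _ G) => n.
  by case: (umP n) => _ [].
have mix (f : dual V) : re (f b) = l * re (x1 f) + (1 - l) * re (x2 f).
  rewrite -l'E.
  have L : re (f ((um n).1.1)) + re (f (um n).1.2) @[n --> G] -->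
      l * re (x1 f) + l' * re (x2 f).
    exact: cvgD (x1P f) (x2P f).
  suff L' : re (f ((um n).1.1)) + re (f (um n).1.2) @[n --> G] --> re (f b).
    exact: (cvg_unique _ L' L).
  apply/cvgrPdist_lt => e e0.
  suff : \forall n \near G,
    `|re (f b) - (re (f ((um n).1.1)) + re (f (um n).1.2))| < e by [].
  apply: GF.
  have n0 : 0 < dual_norm f + 1 by rewrite ltr_wpDl// dual_norm_ge0.
  have en0 : 0 < e / (dual_norm f + 1) by exact: divr_gt0.
  apply: filterS (near_infty_natSinv_lt (PosNum en0)) => n /= ne.
  rewrite -reD -linearD -re_dualB.
  apply: le_lt_trans (re_dual_bound _ _) _.
  have [_ _ bn] := umP n.
  apply: le_lt_trans (_ : (dual_norm f + 1) * rnorm (b - ((um n).1.1 + (um n).1.2)) < _).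
    by rewrite ler_wpM2r ?rnorm_ge0// lerDl.
  by rewrite mulrC -ltr_pdivlMr//; exact: lt_trans bn ne.
rewrite l'E in x2g.
have [l_0|l_neq0] := eqVneq l 0.
  have := mix g2; have := x2g; rewrite l_0 subr0 mul0r mul1r add0r /c2 => /(_ ltr01).
  lra.
have [l_1|l_neq1] := eqVneq (1 - l) 0.
  have lE : l = 1 by lra.
  have := mix g1; have := x1g; rewrite lE subrr mul0r mul1r addr0 /c1 => /(_ ltr01).
  lra.
have l_gt0 : 0 < l by rewrite lt_neqAle eq_sym l_neq0.
have l_lt1 : 0 < 1 - l by rewrite lt_neqAle eq_sym l_neq1.
have [||x1b _] := bext x1 x2 (of_real l) x1cl x2cl.
- by rewrite -(@of_real0 R k) -(@of_real1 R k) !lt_of_real l_gt0 /= -subr_gt0.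
- apply: dual_re_ext => f.
  rewrite -[RHS]/(re (of_real l * x1 f + (1 - of_real l) * x2 f)).
  by rewrite -(@of_real1 R k) -of_realN -of_realD reD !reM_real -mix.
have := x1g l_gt0; rewrite x1b -[to_bidual b g1]/(g1 b) /c1.
lra.
Qed.
End ExtremePoint.

(** * Compact operators near a preserved extreme point *)

Section Compactness.
Context {R : realType} {k : scalar_kind} {X Y : normedModType (scalars R k)}.

Definition half_ball_filter (b : Y) : set_system Y :=
  [set U | exists g, exists2 d : R, 0 < d & half_ball b g d `<=` U].

(** For a single functional [f] in place of [T x], the half-balls given by [f]
    and [- f] bound [re (f y) - re (f b)] on both sides.  Compactness makes
    the choice of the half-ball uniform over the closure of the image of the
    ball, because half-balls generate a filter. *)
Lemma compact_half_ball (T : X -> dual Y) (b : Y) (e : R) : compact_operator T ->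
  unit_ball b ->
  extreme_point (weak_star_closure (@to_bidual R k Y @` unit_ball))
    (to_bidual b) ->
  0 < e ->
  exists g, exists2 d : R, 0 < d & forall x y, unit_ball x -> half_ball b g d y ->
    `|re (T x y) - re (T x b)| < e.
Proof.
move=> Tc b1 bext e0.
have FF : Filter (half_ball_filter b).
  split.
  - by exists 0, 1.
  - move=> U W [g1 [d1 d10 gU]] [g2 [d2 d20 gW]].
    have [g [d d0 gd]] := half_ballI bext g1 g2 d10 d20.
    by exists g, d => // y /gd[/gU ? /gW ?].
  - by move=> U W UW [g [d d0 gU]]; exists g, d => // y /gU /UW.
have e3 : 0 < e / 3 by rewrite divr_gt0.
pose P (y : Y) (f : dual Y) := `|re (f y) - re (f b)| < e.
have := (compact_near_coveringP _).1 Tc _ (half_ball_filter b) P FF.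
case=> [f Kf|g [d d0 gP]]; last first.
  exists g, d => // x y x1 /gP; apply; apply: subset_closure; by exists x.
have [g [d d0 gd]] := half_ballI bext f (- f) e3 e3.
exists ([set f' | rnorm (f - f') < e / 3], half_ball b g d).
  split; last by exists g, d.
  apply/nbhs_normP; exists (of_real (e / 3)) => /=.
    by rewrite -(@of_real0 R k) lt_of_real.
  by move=> h /=; rewrite -rnormK lt_of_real.
move=> [h y] /= [fh /gd[[y1 fy] [_ fy']]].
rewrite /P.
have hy : `|re (f y) - re (h y)| <= rnorm (f - h).
  by rewrite -reN -reD dual_rnormE; exact: (re_dual_le (f - h) y1).
have hb : `|re (f b) - re (h b)| <= rnorm (f - h).
  by rewrite -reN -reD dual_rnormE; exact: (re_dual_le (f - h) b1).
move: fy fy'; rewrite -[(- f) y]/(- f y) -[(- f) b]/(- f b) !reN => fy fy'.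
move: hy hb; rewrite !ler_norml !ltr_norml => /andP[? ?] /andP[? ?].
apply/andP; split; lra.
Qed.
End Compactness.

(** * Functionals on the projective tensor product *)

Section TensorFunctionals.
Context {R : realType} {k : scalar_kind} {X Y : normedModType (scalars R k)}.
Notation Z := (projective_tensor X Y).
Implicit Types (x : X) (y : Y) (G H : dual Z).

Lemma ptens_linearl y : linear (fun x => ptens x y : Z).
Proof. by move=> c u v; rewrite /ptens tensDl tensZl linearP. Qed.

Lemma ptens_linearr x : linear (fun y => ptens x y : Z).
Proof. by move=> c u v; rewrite /ptens tensDr tensZr linearP. Qed.

Lemma ptensZl c x y : ptens (c *: x) y = c *: ptens x y :> Z.
Proof. by rewrite /ptens tensZl linearZ. Qed.

Lemma ptensZr c x y : ptens x (c *: y) = c *: ptens x y :> Z.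
Proof. by rewrite /ptens tensZr linearZ. Qed.

Lemma ptens0l y : ptens 0 y = 0 :> Z.
Proof. by have := ptensZl 0 0 y; rewrite !scale0r. Qed.

Lemma rnorm_ptens_le x y : rnorm (ptens x y : Z) <= rnorm x * rnorm y.
Proof.
rewrite /ptens rnorm_to_completion; apply: projective_norm_le.
by exists [:: (x, y)]; rewrite big_seq1.
Qed.

Lemma unit_ball_ptens x y : unit_ball x -> unit_ball y -> unit_ball (ptens x y : Z).
Proof.
move=> /unit_ballE x1 /unit_ballE y1; apply/unit_ballE.
by apply: le_trans (rnorm_ptens_le x y) _; rewrite mulr_ile1 ?rnorm_ge0.
Qed.

Lemma to_completion_sum (s : seq (X * Y)) :
  to_completion (projective_seminorm X Y) (\sum_(p <- s) tens p.1 p.2) =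
  \sum_(p <- s) ptens p.1 p.2 :> Z.
Proof. exact: linear_sum. Qed.

Lemma le_mul_projective_norm (u : tensor X Y) (C r : R) : 0 <= C ->
  (forall c, projective_costs u c -> r <= C * c) -> r <= C * projective_norm u.
Proof.
rewrite le_eqVlt => /predU1P[<-|C0] h.
  by have [c uc] := (projective_costs_has_inf u).1; have := h c uc; rewrite !mul0r.
by rewrite -ler_pdivrMl//; apply: projective_norm_ge => c /h; rewrite -ler_pdivrMl.
Qed.

(** The unit ball is the closed convex hull of the elementary tensors of the
    two balls. *)
Lemma dual_norm_tensor_le H (M : R) :
  (forall x y, unit_ball x -> unit_ball y -> re (H (ptens x y)) <= M) ->
  dual_norm H <= M.
Proof.
move=> HM.
have M0 : 0 <= M.
  have := HM 0 0 (@unit_ball0 _ _ _) (@unit_ball0 _ _ _).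
  by rewrite ptens0l linear0 re0.
have Hxy x y : re (H (ptens x y)) <= M * (rnorm x * rnorm y).
  have [x1 x1b {1}->] := unit_ball_polar x; have [y1 y1b {1}->] := unit_ball_polar y.
  rewrite ptensZl ptensZr !linearZ /= !reM_real mulrA [leRHS]mulrC.
  by rewrite ler_wpM2l ?mulr_ge0 ?rnorm_ge0 ?HM.
have Hu (u : tensor X Y) :
    re (H (to_completion (projective_seminorm X Y) u)) <= M * projective_norm u.
  apply: le_mul_projective_norm => // c [s -> ->].
  rewrite to_completion_sum linear_sum mulr_sumr.
  rewrite (big_morph _ (@reD R k) re0).
  by apply: ler_sum => q _; exact: Hxy.
apply: dual_norm_re_le => z /unit_ballE z1.
apply/ler_addgt0Pr => e e0.
have n0 : 0 < M + dual_norm H + 1 by rewrite ltr_wpDl// addr_ge0// dual_norm_ge0.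
have d0 : 0 < e / (M + dual_norm H + 1) by exact: divr_gt0.
have [v zv] := to_completion_dense z d0.
set w := to_completion _ v in zv.
have w_le : rnorm w <= 1 + e / (M + dual_norm H + 1).
  have -> : w = z + (w - z) by rewrite addrC subrK.
  by apply: le_trans (rnormD _ _) _; apply: lerD => //; rewrite /rnorm distrC.
have Hw : re (H w) <= M * rnorm w by rewrite /w rnorm_to_completion; exact: Hu.
have := re_dual_bound H (z - w); rewrite re_dualB => /(le_trans (ler_norm _)).
have : dual_norm H * rnorm (z - w) <= dual_norm H * (e / (M + dual_norm H + 1)).
  by rewrite ler_wpM2l// dual_norm_ge0.
have : M * rnorm w <= M * (1 + e / (M + dual_norm H + 1)) by rewrite ler_wpM2l.
have : (M + dual_norm H) * (e / (M + dual_norm H + 1)) <= e.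
  by rewrite mulrCA ler_piMr ?(ltW e0)// ler_pdivrMr// mul1r lerDl.
move: (_ / _) => r; lra.
Qed.

Lemma tensor_rel_sum (f : dual X) (g : dual Y) (s t : seq (X * Y)) :
  tensor_rel s t ->
  \sum_(p <- s) f p.1 * g p.2 = \sum_(p <- t) f p.1 * g p.2.
Proof.
elim=> {s t} //=.
- by move=> t s u _ -> _ ->.
- by move=> s s' t t' _ + _; rewrite !big_cat /= => -> ->.
- by move=> s t; rewrite !big_cat /= addrC.
- by move=> y; rewrite big_seq1 big_nil /= linear0 mul0r.
- by move=> x x' y; rewrite big_seq1 !big_cons big_nil /= linearD mulrDl addr0.
- by move=> x y y'; rewrite big_seq1 !big_cons big_nil /= linearD mulrDr addr0.
- move=> c x y; rewrite !big_seq1 /= !linearZ /=.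
  by rewrite -[c *: f x]/(c * f x) -[c *: g y]/(c * g y) mulrCA mulrA.
Qed.

(** The functional [f (x) g].  Instead of extending it by density, the
    Hahn-Banach theorem is applied to its graph on the sums of elementary
    tensors; the bound by [dual_norm f * dual_norm g] makes this possible. *)
Lemma tensor_functional (f : dual X) (g : dual Y) :
  exists F : dual Z, forall x y, re (F (ptens x y)) = re (f x * g y).
Proof.
pose C := dual_norm f * dual_norm g.
have C0 : 0 <= C by rewrite mulr_ge0 ?dual_norm_ge0.
pose p (z : Z) := C * rnorm z.
have ps : sublinear p.
  split=> [u v|t v t0]; first by rewrite /p -mulrDr ler_wpM2l// rnormD.
  by rewrite /p rnormZ re_of_real_norm ger0_norm// mulrCA.
pose E : set (Z * R) := [set e | exists s : seq (X * Y),
  e = (\sum_(p <- s) ptens p.1 p.2, re (\sum_(p <- s) f p.1 * g p.2))].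
have EC : cone E.
  split.
  - by exists [::]; rewrite !big_nil -(@of_real0 R k) of_realK.
  - by move=> _ _ _ _ [s [-> ->]] [t [-> ->]]; exists (s ++ t); rewrite !big_cat reD.
  - move=> t _ _ _ [s [-> ->]]; exists (scale_seq (of_real t) s).
    rewrite !big_map /= -reM_real scaler_sumr mulr_sumr.
    congr pair; first by apply: eq_bigr => q _; rewrite ptensZl.
    by congr re; apply: eq_bigr => q _; rewrite linearZ /= mulrA.
have [|phi [phil phip phiE]] := hahn_banach ps EC.
  move=> _ _ [s [-> ->]].
  rewrite /p -to_completion_sum rnorm_to_completion.
  apply: le_mul_projective_norm => // c [t st ->].
  rewrite (@tensor_rel_sum f g s t); last by apply/tensor_ofP; rewrite !tensor_ofE.
  rewrite (big_morph _ (@reD R k) re0) mulr_sumr; apply: ler_sum => q _.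
  apply: le_trans (ler_norm _) _; apply: le_trans (re_norm_le _) _.
  rewrite normrM -[`|f _|]rnormK reM_real /C mulrACA.
  by apply: ler_pM; rewrite ?rnorm_ge0 ?dual_bound.
have [F Fphi] := complexify phil phip.
exists F => x y; rewrite Fphi.
have h u : re (f u * g y) <= phi (ptens u y).
  by apply: phiE; exists [:: (u, y)]; rewrite !big_seq1.
apply/eqP; rewrite eq_le h andbT.
have ptensN : ptens (- x) y = - ptens x y :> Z by rewrite -scaleN1r ptensZl scaleN1r.
by have := h (- x); rewrite linearN mulNr reN ptensN real_linearN// lerN2.
Qed.

Lemma tensor_operator G : exists2 T : {linear X -> dual Y},
  bounded_near T (nbhs (0 : X)) & forall x y, T x y = G (ptens x y).
Proof.
have Tdual x : (fun y => G (ptens x y) : (scalars R k)^o) \in @dual_pred R k Y.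
  apply: (@bounded_linear_dual _ _ _ _ (dual_norm G * rnorm x)).
    by move=> c u v; rewrite ptens_linearr linearP.
  move=> y; apply: le_trans (dual_bound G _) _.
  by rewrite -mulrA ler_wpM2l ?dual_norm_ge0// rnorm_ptens_le.
pose T x : dual Y := Dual (Tdual x).
have Tl : linear T.
  by move=> c u v; apply/val_inj/funext => y /=; rewrite ptens_linearl linearP.
pose T' : {linear X -> dual Y} := HB.pack T
  (GRing.isLinear.Build (scalars R k) X (dual Y) _ T Tl).
exists T' => //.
apply/bounded_funP => r; exists (of_real (dual_norm G * re r)) => x xr.
rewrite -[leLHS]rnormK le_of_real dual_rnormE.
apply: dual_norm_le => y /unit_ballE y1.
apply: le_trans (dual_bound G _) _; rewrite ler_wpM2l ?dual_norm_ge0//.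
apply: le_trans (rnorm_ptens_le _ _) _.
apply: le_trans (_ : rnorm x <= _); first by rewrite ler_piMr ?rnorm_ge0.
exact: le_re.
Qed.

Lemma tensor_partial G y : exists f : dual X, forall x, f x = G (ptens x y).
Proof.
have fdual : (fun x => G (ptens x y) : (scalars R k)^o) \in @dual_pred R k X.
  apply: (@bounded_linear_dual _ _ _ _ (dual_norm G * rnorm y)).
    by move=> c u v; rewrite ptens_linearl linearP.
  move=> x; apply: le_trans (dual_bound G _) _.
  by rewrite -mulrA ler_wpM2l ?dual_norm_ge0// mulrC rnorm_ptens_le.
by exists (Dual fdual).
Qed.
End TensorFunctionals.

(** * Slices of the ball of the projective tensor product *)

(** A slice given by the zero functional is the whole ball and may be shrunk to
    any other slice; nonzero functionals make the estimates for [f (x) g]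
    effective. *)
Lemma SCD_nonzero_slices (R : realType) (k : scalar_kind)
    (V : normedModType (scalars R k)) (a : V) (f0 : dual V) :
  f0 != 0 -> SCD unit_ball a ->
  exists (f : nat -> dual V) (alpha : nat -> R),
    (forall n, 0 < dual_norm (f n) /\ 0 < alpha n) /\
    forall (h : dual V) (e : R), 0 < e -> exists n, forall x,
      slice unit_ball (f n) (alpha n) x -> re (h a) - e < re (h x).
Proof.
move=> f00 /SCDP[a1 [f [alpha [alpha0 fP]]]].
have pos (g : dual V) : g != 0 -> 0 < dual_norm g.
  move=> g0; rewrite lt_neqAle dual_norm_ge0 andbT eq_sym.
  by apply: contra g0 => /eqP/dual_norm_eq0 ->.
exists (fun n => if f n == 0 then f0 else f n).
exists (fun n => if f n == 0 then 1 else alpha n).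
split=> [n|h e e0]; first by case: ifPn => fn0; split=> //; exact: pos.
have [n nP] := fP h e e0; exists n => x.
case: ifPn => [/eqP fn0 /slice_unit_ballE[x1 _]|_]; last exact: nP.
apply: nP; apply/slice_unit_ballE; split=> //; rewrite fn0.
have n0 : dual_norm (0 : dual V) <= 0.
  by apply: dual_norm_re_le => y _; rewrite -[(0 : dual V) y]/0 re0.
rewrite -[(0 : dual V) x]/0 re0; have := alpha0 n; lra.
Qed.

Section TensorSlice.
Context {R : realType} {k : scalar_kind} {X Y : normedModType (scalars R k)}.
Notation Z := (projective_tensor X Y).

(** Moving a unimodular factor from [y] to [x] makes [g y] a number [r] with
    [0 <= r <= dual_norm g]; then [re (f x) * r] can be close to
    [dual_norm f * dual_norm g] only if both factors are large. *)
Lemma slice_factors (f : dual X) (g : dual Y) (alpha beta d : R) x y :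
  0 < dual_norm f -> 0 < dual_norm g -> unit_ball x -> unit_ball y ->
  d <= alpha * dual_norm g -> d <= beta * dual_norm f ->
  d <= dual_norm f * dual_norm g ->
  dual_norm f * dual_norm g - d < re (f x * g y) ->
  exists x' y', [/\ slice unit_ball f alpha x', slice unit_ball g beta y'
    & ptens x y = ptens x' y' :> Z].
Proof.
set s := dual_norm f; set t := dual_norm g => s0 t0 x1 y1 da db dst fg.
have [u u1 uE] := re_rot (g y).
have u0 : u != 0 by apply: contra_eq_neq u1 => ->; rewrite normr0 re0 eq_sym oner_eq0.
have gu : g (u *: y) = of_real (rnorm (g y)) by rewrite linearZ rnormK -uE.
exists (u^-1 *: x), (u *: y).
have x1' : unit_ball (u^-1 *: x).
  apply: unit_ball_rot => //; rewrite normfV -(reK (normr_ge0 u)) u1.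
  by rewrite of_real1 invr1 -(@of_real1 R k) of_realK.
have y1' : unit_ball (u *: y) by exact: unit_ball_rot.
have fgE : f x * g y = of_real (rnorm (g y)) * f (u^-1 *: x).
  rewrite -gu !linearZ /= -[u *: g y]/(u * g y) -[u^-1 *: f x]/(u^-1 * f x).
  by rewrite mulrACA mulfV// mul1r mulrC.
move: fg; rewrite fgE reM_real.
have gy0 := rnorm_ge0 (g y); have gyt := dual_norm_ge g y1.
have fxs := le_trans (ler_norm _) (re_dual_le f x1').
rewrite -/s -/t in fxs gyt *.
move: (rnorm (g y)) gu gy0 gyt => r gu r0 rt.
set q := re (f (u^-1 *: x)) in fxs * => h.
have q0 : 0 < q.
  rewrite ltNge; apply/negP => q0; have : r * q <= 0 by rewrite mulr_ge0_le0.
  lra.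
have rq1 : r * q <= t * q by rewrite ler_wpM2r// ltW.
have rq2 : r * q <= r * s by rewrite ler_wpM2l.
split.
- apply/slice_unit_ballE; split=> //; rewrite -/s -/q.
  rewrite -(ltr_pM2r t0) mulrBl; lra.
- apply/slice_unit_ballE; split=> //; rewrite -/t gu of_realK.
  rewrite -(ltr_pM2r s0) mulrBl; lra.
- by rewrite ptensZl ptensZr scalerA mulVf// scale1r.
Qed.

(** When [re (F (ptens x y)) <= s t - d], the constant [C] brings the bound
    [elem] down to [- dual_norm G] at least; otherwise [slice_factors] applies and the
    subtracted term is nonnegative.  The bound says that [C F - G] is at most
    [C s t - c] on elementary tensors. *)
Lemma tensor_slice (f : dual X) (g : dual Y) (F G : dual Z) (alpha beta c : R) :
  0 < dual_norm f -> 0 < dual_norm g -> 0 < alpha -> 0 < beta ->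
  (forall x y, re (F (ptens x y)) = re (f x * g y)) ->
  (forall x y, slice unit_ball f alpha x -> slice unit_ball g beta y ->
     c <= re (G (ptens x y))) ->
  forall e : R, 0 < e -> exists j : nat, forall z,
    slice unit_ball F j.+1%:R^-1 z -> c - e < re (G z).
Proof.
set s := dual_norm f; set t := dual_norm g => s0 t0 a0 b0 FE Gc e e0.
pose d := Num.min (alpha * t) (Num.min (beta * s) (s * t)).
have d0 : 0 < d by rewrite !lt_min !mulr_gt0.
have da : d <= alpha * t by rewrite ge_min lexx.
have db : d <= beta * s by rewrite !ge_min lexx orbT.
have dst : d <= s * t by rewrite !ge_min lexx !orbT.
have st_F : s * t <= dual_norm F.
  rewrite -ler_pdivlMr//; apply: dual_norm_le => x x1.
  rewrite ler_pdivlMr// mulrC.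
  have [->|fx0] := eqVneq (rnorm (f x)) 0; first by rewrite mulr0 dual_norm_ge0.
  have fx_gt0 : 0 < rnorm (f x) by rewrite lt_neqAle eq_sym fx0 rnorm_ge0.
  rewrite -ler_pdivlMr//; apply: dual_norm_le => y y1.
  rewrite ler_pdivlMr//.
  have [u u1 uE] := re_rot (f x * g y).
  have <- : re (F (ptens (u *: x) y)) = rnorm (g y) * rnorm (f x).
    rewrite FE linearZ /= -[u *: f x]/(u * f x) -mulrA uE normrM.
    by rewrite -[`|f x|]rnormK reM_real mulrC.
  apply: le_trans (ler_norm _) _; apply: re_dual_le; apply: unit_ball_ptens => //.
  exact: unit_ball_rot.
pose C := (`|c| + dual_norm G) / d.
have C0 : 0 <= C by rewrite divr_ge0 ?addr_ge0 ?dual_norm_ge0// ltW.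
have elem x y : unit_ball x -> unit_ball y ->
    c - C * (s * t - re (F (ptens x y))) <= re (G (ptens x y)).
  move=> x1 y1; have [Fd|Fd] := leP (re (F (ptens x y))) (s * t - d).
    have : C * d <= C * (s * t - re (F (ptens x y))) by rewrite ler_wpM2l//; lra.
    rewrite {1}/C divfK ?gt_eqF//.
    have := re_dual_le G (unit_ball_ptens x1 y1).
    rewrite ler_norml => /andP[? _]; have := ler_norm c; lra.
  move: (Fd); rewrite {1}FE => /(slice_factors s0 t0 x1 y1 da db dst).
  move=> [x' [y' [fx' gy' ->]]].
  have := Gc _ _ fx' gy'.
  have : 0 <= C * (s * t - re (F (ptens x' y'))).
    rewrite mulr_ge0// subr_ge0 FE.
    have [/slice_unit_ballE[x'1 _] /slice_unit_ballE[y'1 _]] := conj fx' gy'.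
    apply: le_trans (le_trans (ler_norm _) (re_norm_le _)) _.
    rewrite normrM -[`|f x'|]rnormK reM_real ler_pM ?rnorm_ge0//; exact: dual_norm_ge.
  lra.
have HM : dual_norm (of_real C *: F - G) <= C * (s * t) - c.
  apply: dual_norm_tensor_le => x y x1 y1.
  rewrite -[(_ - G) _]/(of_real C * F _ - G _) reD reN reM_real.
  have := elem x y x1 y1; lra.
have e1 : 0 < e / (C + 1) by rewrite divr_gt0// ltr_wpDl.
have [j _ jP] := near_infty_natSinv_lt (PosNum e1).
exists j => z /slice_unit_ballE[z1 Fz].
have /= je := jP j (leqnn j).
move: (j.+1%:R^-1) Fz je => r Fz je.
have := le_trans (le_trans (ler_norm _) (re_dual_le (of_real C *: F - G) z1)) HM.
rewrite -[(_ - G) _]/(of_real C * F z - G z) reD reN reM_real.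
have : C * (s * t - re (F z)) <= C * r by rewrite ler_wpM2l//; lra.
have : C * r <= C * (e / (C + 1)) by rewrite ler_wpM2l// ltW.
have : C * (e / (C + 1)) < e.
  by rewrite mulrCA gtr_pMr// ltr_pdivrMr ?mul1r ?ltrDl// ltr_wpDl.
lra.
Qed.
End TensorSlice.

Theorem theorem4p4 (R : realType) (k : scalar_kind)
    (X Y : completeNormedModType (scalars R k)) (a : X) (b : Y)
    (scd_a : SCD (unit_ball : set X) a)
    (scd_b : SCD (unit_ball : set Y) b)
    (compact_ops : forall T : {linear X -> dual Y},
      bounded_near T (nbhs (0 : X)) -> compact_operator T)
    (preserved_b : preserved_extreme_point (unit_ball : set Y) b) :
  SCD (unit_ball : set (projective_tensor X Y)) (ptens a b).
Proof.
have [_ bext] := preserved_b.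
have a1 : unit_ball a by case: scd_a.
have b1 : unit_ball b by case: scd_b.
apply/SCDP; split; first exact: unit_ball_ptens.
have [[[f0 f00] [g0 g00]]|nofg] :=
  pselect ((exists f : dual X, f != 0) /\ exists g : dual Y, g != 0); last first.
  (* A functional on the tensor product vanishes as soon as its partial
     functionals do. *)
  exists (fun=> 0), (fun=> 1); split=> // h e e0; exists 0%N => z _.
  have -> : h = 0.
    apply: dual_norm_eq0; apply/eqP; rewrite eq_le dual_norm_ge0 andbT.
    apply: dual_norm_tensor_le => x y _ _.
    have [T _ TE] := tensor_operator h; have [S SE] := tensor_partial h y.
    have [S0|S_neq0] := eqVneq S 0.
      by rewrite -SE S0 -[(0 : dual _) _]/0 re0.
    have [T0|T_neq0] := eqVneq (T x) 0.
      by rewrite -TE T0 -[(0 : dual _) _]/0 re0.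
    by case: nofg; split; [exists S|exists (T x)].
  by rewrite -[(0 : dual _) _]/0 -[X in _ < re X]/0 re0; lra.
have [f [alpha [fpos fP]]] := SCD_nonzero_slices f00 scd_a.
have [g [beta [gpos gP]]] := SCD_nonzero_slices g00 scd_b.
have /choice[F FE] (nm : nat * nat) : exists F : dual (projective_tensor X Y),
  forall x y, re (F (ptens x y)) = re (f nm.1 x * g nm.2 y) by exact: tensor_functional.
pose idx (i : nat) : nat * nat * nat := odflt (0, 0, 0)%N (unpickle i).
exists (fun i => F (idx i).1), (fun i => (idx i).2.+1%:R^-1); split=> // G e e0.
have [T Tb TE] := tensor_operator G.
have e4 : 0 < e / 4 by rewrite divr_gt0.
have [h [d d0 hP]] := compact_half_ball (compact_ops T Tb) b1 bext e4.
have [m mP] := gP h d d0.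
have [Ta TaE] := tensor_partial G b.
have [n nP] := fP Ta (e / 4) e4.
have [||||||j jP] := @tensor_slice R k X Y (f n) (g m) (F (n, m)) G
  (alpha n) (beta m) (re (G (ptens a b)) - e / 2) _ _ _ _ (FE (n, m)) _ (e / 2).
- by case: (fpos n).
- by case: (gpos m).
- by case: (fpos n).
- by case: (gpos m).
- move=> x y fx gy.
  have [x1 _] := fx; have [y1 _] := gy.
  have := nP x fx; rewrite !TaE.
  have := hP x y x1 (conj y1 (mP y gy)); rewrite !TE ltr_norml => /andP[? _].
  lra.
- by rewrite divr_gt0.
exists (pickle (n, m, j)) => z.
rewrite /idx pickleK /= => /jP.
lra.
Qed.
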